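(* Let $\Bbbk$ be a field, let $\mathcal T$ be a finite vacant double groupoid with set of boxes $\mathcal B$, and let $(\sigma,\tau)$ be a normalized 2-cocycle on $\mathcal T$ with values in $\Bbbk^\times$. (i) Let $\Bbbk{}^{\tau}_{\sigma}\mathcal T$ be the vector space with basis $\mathcal B$, with multiplication $A.B=\sigma(A,B)\,A\circ_v B$ if $b(A)=t(B)$ and $A.B=0$ otherwise, and comultiplication $\Delta(A)=\sum\tau(B,C)\,B\otimes C$, the sum over all pairs of boxes $(B,C)$ with $r(B)=l(C)$ and $A=BC$. Then $\Bbbk{}^{\tau}_{\sigma}\mathcal T$ (with unit and counit as in the context) is a quantum groupoid with antipode defined by $$\mathcal S(A)=\tau(A,A^h)^{-1}\,\sigma(A^{-1},A^h)^{-1}\,A^{-1},\qquad A\in\mathcal B.$$ The source and target subalgebras are, respectively, the subspaces spanned by $(\mathbf 1_P)_{P\in\mathcal P}$ and $({}_P\mathbf 1)_{P\in\mathcal P}$; so they are commutative of dimension $|\mathcal P|$. (ii) Let $(\nu,\eta)$ be another normalized 2-cocycle on $\mathcal T$ with values in $\Bbbk^\times$, let $\psi:\mathcal B\to\Bbbk^\times$ be a map, and let $\Psi:\Bbbk{}^{\tau}_{\sigma}\mathcal T\to\Bbbk{}^{\eta}_{\nu}\mathcal T$ be the linear map given by $\Psi(B)=\psi(B)B$, $B\in\mathcal B$. Then $\Psi$ is an isomorphism of quantum groupoids if and only if $$\psi(A\circ_v B)\,\sigma(A,B)=\psi(A)\psi(B)\,\nu(A,B)\quad\text{for all }A,B\in\mathcal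 B\text{ with }b(A)=t(B),$$ $$\psi(CD)\,\eta(C,D)=\psi(C)\psi(D)\,\tau(C,D)\quad\text{for all }C,D\in\mathcal B\text{ with }r(C)=l(D).$$
   Context: Convention: in a category, $fg$ means ''first $f$, then $g$'' (defined when target of $f$ = source of $g$). Double categories. A (small) double category $\mathcal T$ consists of non-empty sets $\mathcal B$ (boxes), $\mathcal H$ (horizontal edges), $\mathcal V$ (vertical edges), $\mathcal P$ (points) and four categories: (arrows $\mathcal B$, objects $\mathcal H$, source $t$, target $b$), whose composition is called vertical; (arrows $\mathcal B$, objects $\mathcal V$, source $l$, target $r$), whose composition is called horizontal; (arrows $\mathcal H$, objects $\mathcal P$, source $l$, target $r$); (arrows $\mathcal V$, objects $\mathcal P$, source $t$, target $b$). Write $A\circ_v B$ ($A$ on top of $B$) for the vertical composite, defined when $b(A)=t(B)$, and $AB$ for the horizontal composite, defined when $r(A)=l(B)$. Write $\mathrm{id}_P$ for the identities in $\mathcal H$ and in $\mathcal V$ at $P\in\mathcal P$; for $x\in\mathcal H$, $\mathbf{id}_x\in\mathcal B$ is the identity of $x$ for vertical composition (a ''vertical identity''); for $g\in\mathcal V$, $\mathbf{id}_g\in\mathcal B$ is the identity of $g$ for horizontal composition (a ''horizontal identity''). Axioms: (1) $tr=rt$, $tl=lt$, $bl=lb$, $br=rb$ as maps $\mathcal B\to\mathcal P$; (2) $t(AB)=t(A)t(B)$, $b(AB)=b(A)b(B)$, $l(A\circ_v B)=l(A)l(B)$, $r(A\circ_v B)=r(A)r(B)$; (3) interchange: $(AB)\circ_v(CD)=(A\circ_v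 C)(B\circ_v D)$ whenever $r(A)=l(B)$, $r(C)=l(D)$, $b(A)=t(C)$, $b(B)=t(D)$; (4) for $x\in\mathcal H$, $l(\mathbf{id}_x)=\mathrm{id}_{l(x)}$, $r(\mathbf{id}_x)=\mathrm{id}_{r(x)}$; for $g\in\mathcal V$, $t(\mathbf{id}_g)=\mathrm{id}_{t(g)}$, $b(\mathbf{id}_g)=\mathrm{id}_{b(g)}$; (5) for $P\in\mathcal P$ the vertical identity of the horizontal edge $\mathrm{id}_P$ equals the horizontal identity of the vertical edge $\mathrm{id}_P$; (6) $\mathbf{id}_g\circ_v\mathbf{id}_h=\mathbf{id}_{gh}$ for composable $g,h\in\mathcal V$ and $\mathbf{id}_x\mathbf{id}_y=\mathbf{id}_{xy}$ for composable $x,y\in\mathcal H$. A double groupoid is a double category all four of whose categories are groupoids. $A^h$, $A^v$ denote the inverses of a box $A$ for horizontal and vertical composition, and $A^{-1}:=(A^h)^v=(A^v)^h$. It is finite if $\mathcal B,\mathcal H,\mathcal V,\mathcal P$ are finite. It is vacant if for all $g\in\mathcal V$, $x\in\mathcal H$ with $r(x)=t(g)$ there is exactly one $X\in\mathcal B$ with $t(X)=x$, $r(X)=g$. Normalized 2-cocycle on $\mathcal T$ with values in $\Bbbk^\times$: a pair $(\sigma,\tau)$ where $\sigma$ is a $\Bbbk^\times$-valued function on pairs $(A,B)$ of boxes with $b(A)=t(B)$, and $\tau$ a $\Bbbk^\times$-valued function on pairs $(A,B)$ with $r(A)=l(B)$, such that: $\sigma(A,B)\sigma(A\circ_v B,C)=\sigma(B,C)\sigma(A,B\circ_v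 C)$ for vertically composable $A,B,C$; $\sigma(A,B)=1$ if $A$ or $B$ is a vertical identity; $\tau(A,B)\tau(AB,C)=\tau(B,C)\tau(A,BC)$ for horizontally composable $A,B,C$; $\tau(A,B)=1$ if $A$ or $B$ is a horizontal identity; and, whenever $r(A)=l(B)$, $r(C)=l(D)$, $b(A)=t(C)$, $b(B)=t(D)$, $\sigma(AB,CD)\,\tau(A\circ_v C,B\circ_v D)=\tau(A,B)\tau(C,D)\sigma(A,C)\sigma(B,D)$. Unit and counit of $\Bbbk{}^{\tau}_{\sigma}\mathcal T$: $\mathbf 1=\sum_{x\in\mathcal H}\mathbf{id}_x$; $\varepsilon(A)=1$ if $A=\mathbf{id}_{l(A)}$ is a horizontal identity and $\varepsilon(A)=0$ otherwise. For $P\in\mathcal P$, ${}_P\mathbf 1=\sum_{x\in\mathcal H,\,l(x)=P}\mathbf{id}_x$ and $\mathbf 1_P=\sum_{x\in\mathcal H,\,r(x)=P}\mathbf{id}_x$. Weak Hopf algebra (= quantum groupoid): an associative unital algebra and coassociative counital coalgebra $H$ with $\Delta(ab)=\Delta(a)\Delta(b)$; $\Delta^{(2)}(1)=(\Delta(1)\otimes1)(1\otimes\Delta(1))=(1\otimes\Delta(1))(\Delta(1)\otimes1)$; $\varepsilon(abc)=\varepsilon(ab_1)\varepsilon(b_2c)=\varepsilon(ab_2)\varepsilon(b_1c)$ (Sweedler notation); and a linear antipode $\mathcal S:H\to H$ with $m(\mathrm{id}\otimes\mathcal S)\Delta(h)=(\varepsilon\otimes\mathrm{id})(\Delta(1)(h\otimes1))=:\varepsilon_t(h)$,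 $m(\mathcal S\otimes\mathrm{id})\Delta(h)=(\mathrm{id}\otimes\varepsilon)((1\otimes h)\Delta(1))=:\varepsilon_s(h)$, $m^{(2)}(\mathcal S\otimes\mathrm{id}\otimes\mathcal S)\Delta^{(2)}=\mathcal S$. The source and target subalgebras are the images of $\varepsilon_s$ and $\varepsilon_t$ respectively. An isomorphism of quantum groupoids is a bijective linear map preserving multiplication, unit, comultiplication, counit and antipode. *)

(* Defs.v *)
From HB Require Import structures.
From mathcomp Require Import all_boot all_order all_algebra.

Set Implicit Arguments.
Unset Strict Implicit.
Unset Printing Implicit Defensive.

Import GRing.Theory.
Local Open Scope ring_scope.

(* Composition is a total function; it is only constrained, and only ever used,
   on composable pairs.  [ccomp C f g] is "first f, then g". *)
Record category (Ob Ar : Type) := Category {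
  src : Ar -> Ob;
  tgt : Ar -> Ob;
  idc : Ob -> Ar;
  ccomp : Ar -> Ar -> Ar;
  src_idc : forall x, src (idc x) = x;
  tgt_idc : forall x, tgt (idc x) = x;
  src_comp : forall f g, tgt f = src g -> src (ccomp f g) = src f;
  tgt_comp : forall f g, tgt f = src g -> tgt (ccomp f g) = tgt g;
  comp_idl : forall f, ccomp (idc (src f)) f = f;
  comp_idr : forall f, ccomp f (idc (tgt f)) = f;
  compA : forall f g h, tgt f = src g -> tgt g = src h ->
    ccomp (ccomp f g) h = ccomp f (ccomp g h)
}.

(* [inv] makes [C] a groupoid. *)
Definition is_inverse (Ob Ar : Type) (C : category Ob Ar) (inv : Ar -> Ar) :=
  forall f, [/\ src C (inv f) = tgt C f, tgt C (inv f) = src C f,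
    ccomp C f (inv f) = idc C (src C f) & ccomp C (inv f) f = idc C (tgt C f)].

(* The four categories: [vbox] has arrows B, objects H, source t, target b;
   [hbox] has arrows B, objects V, source l, target r; [hedge] has arrows H,
   objects P, source l, target r; [vedge] has arrows V, objects P, source t,
   target b. *)
Record double_category (B H V P : Type) := DoubleCategory {
  vbox : category H B;
  hbox : category V B;
  hedge : category P H;
  vedge : category P V;
  inhabited_boxes : inhabited B;
  inhabited_hedges : inhabited H;
  inhabited_vedges : inhabited V;
  inhabited_points : inhabited P;
  corner_tr : forall A, tgt hedge (src vbox A) = src vedge (tgt hbox A);
  corner_tl : forall A, src hedge (src vbox A) = src vedge (src hbox A);
  corner_bl : forall A, src hedge (tgt vbox A) = tgt vedge (src hbox A);
  corner_br : forall A, tgt hedge (tgt vbox A) = tgt vedge (tgt hbox A);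
  top_hcomp : forall A A', tgt hbox A = src hbox A' ->
    src vbox (ccomp hbox A A') = ccomp hedge (src vbox A) (src vbox A');
  bot_hcomp : forall A A', tgt hbox A = src hbox A' ->
    tgt vbox (ccomp hbox A A') = ccomp hedge (tgt vbox A) (tgt vbox A');
  left_vcomp : forall A A', tgt vbox A = src vbox A' ->
    src hbox (ccomp vbox A A') = ccomp vedge (src hbox A) (src hbox A');
  right_vcomp : forall A A', tgt vbox A = src vbox A' ->
    tgt hbox (ccomp vbox A A') = ccomp vedge (tgt hbox A) (tgt hbox A');
  interchange : forall A A' C C',
    tgt hbox A = src hbox A' -> tgt hbox C = src hbox C' ->
    tgt vbox A = src vbox C -> tgt vbox A' = src vbox C' ->
    ccomp vbox (ccomp hbox A A') (ccomp hbox C C')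
    = ccomp hbox (ccomp vbox A C) (ccomp vbox A' C');
  left_vid : forall x, src hbox (idc vbox x) = idc vedge (src hedge x);
  right_vid : forall x, tgt hbox (idc vbox x) = idc vedge (tgt hedge x);
  top_hid : forall g, src vbox (idc hbox g) = idc hedge (src vedge g);
  bot_hid : forall g, tgt vbox (idc hbox g) = idc hedge (tgt vedge g);
  vid_hid : forall p, idc vbox (idc hedge p) = idc hbox (idc vedge p);
  vcomp_hid : forall g h, tgt vedge g = src vedge h ->
    ccomp vbox (idc hbox g) (idc hbox h) = idc hbox (ccomp vedge g h);
  hcomp_vid : forall x y, tgt hedge x = src hedge y ->
    ccomp hbox (idc vbox x) (idc vbox y) = idc vbox (ccomp hedge x y)
}.

Record double_groupoid (B H V P : Type) := DoubleGroupoid {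
  dgcat :> double_category B H V P;
  vinv : B -> B;
  hinv : B -> B;
  hedge_inv : H -> H;
  vedge_inv : V -> V;
  vinvP : is_inverse (vbox dgcat) vinv;
  hinvP : is_inverse (hbox dgcat) hinv;
  hedge_invP : is_inverse (hedge dgcat) hedge_inv;
  vedge_invP : is_inverse (vedge dgcat) vedge_inv
}.

Section Boxes.
Variables (B H V P : Type).

Definition top (T : double_category B H V P) : B -> H := src (vbox T).
Definition bot (T : double_category B H V P) : B -> H := tgt (vbox T).
Definition left (T : double_category B H V P) : B -> V := src (hbox T).
Definition right (T : double_category B H V P) : B -> V := tgt (hbox T).
Definition vcomp (T : double_category B H V P) : B -> B -> B := ccomp (vbox T).
Definition hcomp (T : double_category B H V P) : B -> B -> B := ccomp (hbox T).
Definition vid (T : double_category B H V P) : H -> B := idc (vbox T).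
Definition hid (T : double_category B H V P) : V -> B := idc (hbox T).

Definition vacant (T : double_groupoid B H V P) : Prop :=
  forall (g : V) (x : H), tgt (hedge T) x = src (vedge T) g ->
    exists! X : B, top T X = x /\ right T X = g.

(* The values of [sigma] (resp. [tau]) on pairs which are not vertically (resp.
   horizontally) composable are irrelevant. *)
Record normalized_cocycle (k : fieldType) (T : double_category B H V P)
    (sigma tau : B -> B -> k) : Prop := NormalizedCocycle {
  sigma_neq0 : forall A C, bot T A = top T C -> sigma A C != 0;
  tau_neq0 : forall A C, right T A = left T C -> tau A C != 0;
  sigma_cocycle : forall A C D, bot T A = top T C -> bot T C = top T D ->
    sigma A C * sigma (vcomp T A C) D = sigma C D * sigma A (vcomp T C D);
  sigma_vidl : forall x C, bot T (vid T x) = top T C -> sigma (vid T x) C = 1;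
  sigma_vidr : forall A x, bot T A = top T (vid T x) -> sigma A (vid T x) = 1;
  tau_cocycle : forall A C D, right T A = left T C -> right T C = left T D ->
    tau A C * tau (hcomp T A C) D = tau C D * tau A (hcomp T C D);
  tau_hidl : forall g C, right T (hid T g) = left T C -> tau (hid T g) C = 1;
  tau_hidr : forall A g, right T A = left T (hid T g) -> tau A (hid T g) = 1;
  sigma_tau : forall A A' C C',
    right T A = left T A' -> right T C = left T C' ->
    bot T A = top T C -> bot T A' = top T C' ->
    sigma (hcomp T A A') (hcomp T C C') * tau (vcomp T A C) (vcomp T A' C')
    = tau A A' * tau C C' * sigma A C * sigma A' C'
}.

End Boxes.

(* The vector space with basis X.  The tensor product of the spaces with bases
   X and Y is the space with basis X * Y, so that the second and third tensor
   powers of [freemod k X] are [freemod k (X * X)] and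
   [freemod k (X * X * X)]. *)
Notation freemod k X := {ffun X -> GRing.regular k}.

Section FreeModules.
Variable k : fieldType.

Definition basis (X : finType) (x : X) : freemod k X := [ffun y => (y == x)%:R].

Definition linext (X : finType) (W : lmodType k) (f : X -> W)
    (t : freemod k X) : W :=
  \sum_(x : X) (t x : k) *: f x.

Lemma linext_is_linear (X : finType) (W : lmodType k) (f : X -> W) :
  linear (linext f).
Proof.
move=> a u v; rewrite /linext scaler_sumr -big_split; apply: eq_bigr => x _ /=.
by rewrite !ffunE scalerDl scalerA.
Qed.

HB.instance Definition _ (X : finType) (W : lmodType k) (f : X -> W) :=
  GRing.isLinear.Build k (freemod k X) W *:%R (linext f) (linext_is_linear f).

Definition tens (X Y : finType) (u : freemod k X) (v : freemod k Y) :
    freemod k (X * Y)%type :=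
  [ffun p => (u p.1 : k) * (v p.2 : k)].

Lemma tens_linearl (X Y : finType) (v : freemod k Y) :
  linear (fun u : freemod k X => tens u v).
Proof. by move=> a u w; apply/ffunP => p; rewrite !ffunE mulrDl -mulrA. Qed.

Lemma tens_linearr (X Y : finType) (u : freemod k X) :
  linear (fun v : freemod k Y => tens u v).
Proof. by move=> a v w; apply/ffunP => p; rewrite !ffunE mulrDr mulrCA. Qed.

Definition tmap (X Y X' Y' : finType)
    (f : {linear freemod k X -> freemod k X'})
    (g : {linear freemod k Y -> freemod k Y'}) :
    {linear freemod k (X * Y)%type -> freemod k (X' * Y')%type} :=
  linext (fun p => tens (f (basis p.1)) (g (basis p.2))).

Definition idlin (X : finType) : {linear freemod k X -> freemod k X} := idfun.

Definition reassoc (X Y Z : finType) (t : freemod k (X * (Y * Z))%type) :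
    freemod k (X * Y * Z)%type :=
  [ffun p => t (p.1.1, (p.1.2, p.2))].

(* f \otimes id and id \otimes f, for a linear form f, with k \otimes W and
   W \otimes k identified with W. *)
Definition form_id (X Y : finType) (f : {linear freemod k X -> k^o}) :
    {linear freemod k (X * Y)%type -> freemod k Y} :=
  linext (fun p => (f (basis p.1) : k) *: basis p.2).

Definition id_form (X Y : finType) (f : {linear freemod k Y -> k^o}) :
    {linear freemod k (X * Y)%type -> freemod k X} :=
  linext (fun p => (f (basis p.2) : k) *: basis p.1).

(* The multiplication (a \otimes b)(c \otimes d) = ac \otimes bd. *)
Definition tmul (X Y : finType)
    (m : {linear freemod k (X * X)%type -> freemod k X})
    (n : {linear freemod k (Y * Y)%type -> freemod k Y}) :
    {linear freemod k ((X * Y) * (X * Y))%type -> freemod k (X * Y)%type} :=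
  linext (fun p => tens (m (tens (basis p.1.1) (basis p.2.1)))
                        (n (tens (basis p.1.2) (basis p.2.2)))).

Record wha_data (X : finType) := WhaData {
  mult : {linear freemod k (X * X)%type -> freemod k X};
  unit_elt : freemod k X;
  comult : {linear freemod k X -> freemod k (X * X)%type};
  counit : {linear freemod k X -> k^o};
  antipode : {linear freemod k X -> freemod k X}
}.

Section WeakHopf.
Variables (X : finType) (W : wha_data X).
Local Notation e := (@basis X).

Definition wmul (a b : freemod k X) : freemod k X := mult W (tens a b).

Definition mul2 (s t : freemod k (X * X)%type) : freemod k (X * X)%type :=
  tmul (mult W) (mult W) (tens s t).

Definition mul3 (s t : freemod k (X * X * X)%type) :
    freemod k (X * X * X)%type :=
  tmul (tmul (mult W) (mult W)) (mult W) (tens s t).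

Definition comult2 (a : freemod k X) : freemod k (X * X * X)%type :=
  tmap (comult W) (idlin X) (comult W a).

Definition counital_target (h : freemod k X) : freemod k X :=
  form_id X (counit W) (mul2 (comult W (unit_elt W)) (tens h (unit_elt W))).

Definition counital_source (h : freemod k X) : freemod k X :=
  id_form X (counit W) (mul2 (tens (unit_elt W) h) (comult W (unit_elt W))).

Lemma counital_target_linear : linear counital_target.
Proof.
move=> a u v; rewrite /counital_target /mul2.
by rewrite tens_linearl tens_linearr !linearP.
Qed.

Lemma counital_source_linear : linear counital_source.
Proof.
move=> a u v; rewrite /counital_source /mul2.
by rewrite tens_linearr tens_linearl !linearP.
Qed.

HB.instance Definition _ :=
  GRing.isLinear.Build k (freemod k X) (freemod k X) *:%R
    counital_target counital_target_linear.
HB.instance Definition _ :=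
  GRing.isLinear.Build k (freemod k X) (freemod k X) *:%R
    counital_source counital_source_linear.

Definition target_subalgebra : {vspace freemod k X} :=
  limg (linfun counital_target).
Definition source_subalgebra : {vspace freemod k X} :=
  limg (linfun counital_source).

Definition commutative_subalgebra (U : {vspace freemod k X}) : Prop :=
  [/\ unit_elt W \in U, {in U &, forall a b, wmul a b \in U}
    & {in U &, forall a b, wmul a b = wmul b a}].

(* In the two counit axioms, the sums over p expand the Sweedler components of
   the comultiplication of b in the basis X * X. *)
Record quantum_groupoid : Prop := QuantumGroupoid {
  mul_assoc : forall a b c, wmul a (wmul b c) = wmul (wmul a b) c;
  mul_onel : forall a, wmul (unit_elt W) a = a;
  mul_oner : forall a, wmul a (unit_elt W) = a;
  comult_coassoc : forall a,
    tmap (comult W) (idlin X) (comult W a)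
    = reassoc (tmap (idlin X) (comult W) (comult W a));
  counit_comultl : forall a, form_id X (counit W) (comult W a) = a;
  counit_comultr : forall a, id_form X (counit W) (comult W a) = a;
  comult_mul : forall a b,
    comult W (wmul a b) = mul2 (comult W a) (comult W b);
  comult2_one_l : comult2 (unit_elt W)
    = mul3 (tens (comult W (unit_elt W)) (unit_elt W))
           (reassoc (tens (unit_elt W) (comult W (unit_elt W))));
  comult2_one_r : comult2 (unit_elt W)
    = mul3 (reassoc (tens (unit_elt W) (comult W (unit_elt W))))
           (tens (comult W (unit_elt W)) (unit_elt W));
  counit_mul_l : forall a b c, counit W (wmul (wmul a b) c)
    = \sum_(p : X * X) comult W b p *
        (counit W (wmul a (e p.1)) * counit W (wmul (e p.2) c));
  counit_mul_r : forall a b c, counit W (wmul (wmul a b) c)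
    = \sum_(p : X * X) comult W b p *
        (counit W (wmul a (e p.2)) * counit W (wmul (e p.1) c));
  antipode_target : forall h,
    mult W (tmap (idlin X) (antipode W) (comult W h)) = counital_target h;
  antipode_source : forall h,
    mult W (tmap (antipode W) (idlin X) (comult W h)) = counital_source h;
  antipode_antipode : forall h,
    mult W (tmap (mult W) (idlin X)
      (tmap (tmap (antipode W) (idlin X)) (antipode W) (comult2 h)))
    = antipode W h
}.

End WeakHopf.

Record quantum_groupoid_iso (X Y : finType) (W : wha_data X) (W' : wha_data Y)
    (f : {linear freemod k X -> freemod k Y}) : Prop := QuantumGroupoidIso {
  iso_bij : bijective f;
  iso_mul : forall a b, f (wmul W a b) = wmul W' (f a) (f b);
  iso_one : f (unit_elt W) = unit_elt W';
  iso_comult : forall a, tmap f f (comult W a) = comult W' (f a);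
  iso_counit : forall a, counit W' (f a) = counit W a;
  iso_antipode : forall a, f (antipode W a) = antipode W' (f a)
}.

End FreeModules.

Section TwistedGroupoidAlgebra.
Variables (k : fieldType) (B H V P : finType) (T : double_groupoid B H V P).
Variables (sigma tau : B -> B -> k).
Local Notation e := (@basis k B).

Definition twisted_mult : {linear freemod k (B * B)%type -> freemod k B} :=
  linext (fun p => if bot T p.1 == top T p.2
    then sigma p.1 p.2 *: e (vcomp T p.1 p.2) else 0).

Definition twisted_one : freemod k B := \sum_(x : H) e (vid T x).

Definition twisted_comult : {linear freemod k B -> freemod k (B * B)%type} :=
  linext (fun A =>
    \sum_(p : B * B | (right T p.1 == left T p.2) && (A == hcomp T p.1 p.2))
      tau p.1 p.2 *: tens (e p.1) (e p.2)).

Definition twisted_counit : {linear freemod k B -> k^o} :=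
  linext (fun A => (A == hid T (left T A))%:R).

Definition twisted_antipode : {linear freemod k B -> freemod k B} :=
  linext (fun A =>
    ((tau A (hinv T A))^-1 * (sigma (vinv T (hinv T A)) (hinv T A))^-1)
      *: e (vinv T (hinv T A))).

Definition twisted_alg : wha_data k B :=
  WhaData twisted_mult twisted_one twisted_comult twisted_counit
    twisted_antipode.

Definition one_from (p : P) : freemod k B :=
  \sum_(x : H | src (hedge T) x == p) e (vid T x).
Definition one_to (p : P) : freemod k B :=
  \sum_(x : H | tgt (hedge T) x == p) e (vid T x).

End TwistedGroupoidAlgebra.

Definition rescale (k : fieldType) (B : finType) (psi : B -> k) :
    {linear freemod k B -> freemod k B} :=
  linext (fun A => psi A *: basis k A).

(* Main.v *)
(* In a vacant double groupoid a box is determined by its top and right sides,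
   hence also by its bottom and right, or its top and left sides.  So a box is a
   horizontal (vertical) identity as soon as its top or bottom (left or right)
   side is an identity, and a horizontal factorization of a vertical composite
   lifts uniquely to its two factors; the latter, with the compatibility of sigma
   and tau, is the multiplicativity of the comultiplication.  The
   comultiplication is dual to horizontal composition:
   Delta(a)(B, C) = tau(B, C) a(BC), so coassociativity is pointwise.  In the
   antipode axioms a factorization A = BC contributes only if C = B^h, which
   needs A to be a horizontal identity, and there the scalars cancel.  The
   counital maps send h to a combination of the orthogonal idempotents attached
   to the points, which gives the source and target subalgebras. *)
Require Import Defs.
From HB Require Import structures.
From mathcomp Require Import all_boot all_order all_algebra ring.

Set Implicit Arguments.
Unset Strict Implicit.
Unset Printing Implicit Defensive.

Import GRing.Theory.
Local Open Scope ring_scope.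

(** * Groupoids *)

Section Groupoids.
Variables (Ob Ar : Type) (C : category Ob Ar) (inv : Ar -> Ar).
Hypothesis invP : is_inverse C inv.

Lemma src_inv f : src C (inv f) = tgt C f. Proof. by case: (invP f). Qed.
Lemma tgt_inv f : tgt C (inv f) = src C f. Proof. by case: (invP f). Qed.
Lemma comp_inv f : ccomp C f (inv f) = idc C (src C f).
Proof. by case: (invP f). Qed.
Lemma inv_comp f : ccomp C (inv f) f = idc C (tgt C f).
Proof. by case: (invP f). Qed.

Lemma compK f g : tgt C f = src C g -> ccomp C (inv f) (ccomp C f g) = g.
Proof. by move=> fg; rewrite -Defs.compA ?tgt_inv // inv_comp fg comp_idl. Qed.

Lemma inv_unique f g : tgt C f = src C g ->
  ccomp C f g = idc C (src C f) -> g = inv f.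
Proof.
by move=> fg fg1; rewrite -[LHS](compK fg) fg1 -tgt_inv comp_idr.
Qed.

Lemma invK : involutive inv.
Proof.
by move=> f; apply/esym/inv_unique; rewrite ?tgt_inv // inv_comp src_inv.
Qed.

Lemma comp_cancelr f g h : tgt C f = src C h -> tgt C g = src C h ->
  ccomp C f h = ccomp C g h -> f = g.
Proof.
move=> fh gh e; have K u : tgt C u = src C h ->
    ccomp C (ccomp C u h) (inv h) = u.
  by move=> uh; rewrite Defs.compA ?src_inv // comp_inv -uh comp_idr.
by rewrite -(K f) // e K.
Qed.

Lemma idc_inj : injective (idc C).
Proof. by move=> x y e; rewrite -(src_idc C x) e src_idc. Qed.

End Groupoids.

Lemma sum_pair (R : nmodType) (X Y : finType) (F : X * Y -> R) :
  \sum_p F p = \sum_x \sum_y F (x, y).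
Proof. by rewrite pair_bigA; apply: eq_bigr => -[]. Qed.

(** * Free modules and diagonal products *)

Section FreeModules.
Variable k : fieldType.
Local Notation e := (basis k).

Lemma basisE (X : finType) (x y : X) : e x y = (y == x)%:R :> k.
Proof. exact: ffunE. Qed.

Lemma linext_basis (X : finType) (W : lmodType k) (f : X -> W) x :
  linext f (e x) = f x.
Proof.
rewrite /linext (bigD1 x) //= big1 => [|y /negbTE yx].
  by rewrite basisE eqxx scale1r addr0.
by rewrite basisE yx scale0r.
Qed.

Lemma linextE (X Y : finType) (f : X -> freemod k Y) t y :
  linext f t y = \sum_x (t x : k) * f x y.
Proof. by rewrite /linext sum_ffunE; apply: eq_bigr => x _; rewrite ffunE. Qed.

Lemma basis_sum (X : finType) (a : freemod k X) :
  a = \sum_x (a x : k) *: e x.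
Proof.
apply/ffunP => y; rewrite sum_ffunE (bigD1 y) //= big1 => [|x /negbTE xy].
  by rewrite !ffunE eqxx addr0; exact/esym/mulr1.
by rewrite !ffunE eq_sym xy; exact: mulr0.
Qed.

(** It takes bare functions with linearity proofs, so that a multilinear identity can be reduced to
    the basis one variable at a time. *)
Lemma linear_basis_ext (X : finType) (W : lmodType k)
    (f g : freemod k X -> W) :
  linear f -> linear g -> (forall x, f (e x) = g (e x)) -> f =1 g.
Proof.
move=> lf lg fg a; pose F := GRing.isLinear.Build _ _ _ _ f lf.
pose G := GRing.isLinear.Build _ _ _ _ g lg.
pose f' : {linear _ -> _} := HB.pack f F; pose g' : {linear _ -> _} := HB.pack g G.
rewrite -[f]/(f' : _ -> _) -[g]/(g' : _ -> _) (basis_sum a) !linear_sum.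
by apply: eq_bigr => x _; rewrite !linearZ /= fg.
Qed.

Lemma linE (X : finType) (W : lmodType k) (f : {linear freemod k X -> W}) a :
  f a = \sum_x (a x : k) *: f (e x).
Proof.
by rewrite {1}(basis_sum a) linear_sum; apply: eq_bigr => x _; rewrite linearZ.
Qed.

Lemma linear_sum_fun (X I : finType) (W : lmodType k)
    (F : I -> freemod k X -> W) :
  (forall i, linear (F i)) -> linear (fun a => \sum_i F i a).
Proof.
move=> lF z u v; rewrite scaler_sumr -big_split.
by apply: eq_bigr => i _; rewrite lF.
Qed.

Lemma linear_mull (X : finType) (f : freemod k X -> k^o) (c : k) :
  linear f -> linear (fun a => c * f a : k^o).
Proof. by move=> lf z u v; rewrite lf mulrDr; congr (_ + _); exact: mulrCA. Qed.

Lemma linear_mulr (X : finType) (f : freemod k X -> k^o) (c : k) :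
  linear f -> linear (fun a => f a * c : k^o).
Proof. by move=> lf z u v; rewrite lf mulrDl -mulrA. Qed.

Lemma tens_basis (X Y : finType) (x : X) (y : Y) : tens (e x) (e y) = e (x, y).
Proof.
by apply/ffunP => -[a b]; rewrite !ffunE xpair_eqE /= -natrM mulnb.
Qed.

Lemma tmap_basis (X Y X' Y' : finType) (f : {linear freemod k X -> freemod k X'})
    (g : {linear freemod k Y -> freemod k Y'}) p :
  tmap f g (e p) = tens (f (e p.1)) (g (e p.2)).
Proof. exact: linext_basis. Qed.

(** Evaluation freezes the untouched tensor factor: [f] acts on the slice of [t] over [z].
    Coassociativity thereby becomes a pointwise identity. *)
Lemma tmap_idr (X Y Z : finType) (f : {linear freemod k X -> freemod k Y}) t y z :
  tmap f (idlin k Z) t (y, z) = f [ffun x => t (x, z)] y.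
Proof.
rewrite linextE (linE f) sum_ffunE.
under [RHS]eq_bigr do rewrite !ffunE.
rewrite sum_pair /=.
apply: eq_bigr => x _; rewrite (bigD1 z) //= big1 => [|w /negbTE wz].
  by rewrite !ffunE /= eqxx mulr1 addr0.
by rewrite !ffunE /= eq_sym wz !mulr0.
Qed.

Lemma tmap_idl (X Y Z : finType) (f : {linear freemod k X -> freemod k Y}) t z y :
  tmap (idlin k Z) f t (z, y) = f [ffun x => t (z, x)] y.
Proof.
rewrite linextE (linE f) sum_ffunE.
under [RHS]eq_bigr do rewrite !ffunE.
rewrite sum_pair /=.
rewrite exchange_big; apply: eq_bigr => x _ /=.
rewrite (bigD1 z) //= big1 => [|w /negbTE wz].
  by rewrite !ffunE /= eqxx mul1r addr0.
by rewrite !ffunE /= eq_sym wz mul0r mulr0.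
Qed.

Lemma form_idE (X Y : finType) (f : {linear freemod k X -> k^o}) t y :
  form_id Y f t y = f [ffun x => t (x, y)].
Proof.
rewrite linextE (linE f).
under [RHS]eq_bigr do rewrite !ffunE.
rewrite sum_pair /=.
apply: eq_bigr => x _; rewrite (bigD1 y) //= big1 => [|w /negbTE wz].
  by rewrite !ffunE /= eqxx addr0; congr (_ * _); exact: mulr1.
by rewrite !ffunE /= eq_sym wz; rewrite [_ *: _]mulr0 mulr0.
Qed.

Lemma id_formE (X Y : finType) (f : {linear freemod k Y -> k^o}) t x :
  id_form X f t x = f [ffun y => t (x, y)].
Proof.
rewrite linextE (linE f).
under [RHS]eq_bigr do rewrite !ffunE.
rewrite sum_pair /=.
rewrite exchange_big; apply: eq_bigr => y _ /=.
rewrite (bigD1 x) //= big1 => [|w /negbTE wz].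
  by rewrite !ffunE /= eqxx addr0; congr (_ * _); exact: mulr1.
by rewrite !ffunE /= eq_sym wz; rewrite [_ *: _]mulr0 mulr0.
Qed.

(** The composites are given only up to pointwise equality, so that [f''] can be a named map such as
    [counital_source W]. *)
Lemma tmap_tmap (X Y X' Y' X'' Y'' : finType)
    (f : {linear freemod k X -> freemod k X'})
    (g : {linear freemod k Y -> freemod k Y'})
    (f' : {linear freemod k X' -> freemod k X''})
    (g' : {linear freemod k Y' -> freemod k Y''})
    (f'' : {linear freemod k X -> freemod k X''})
    (g'' : {linear freemod k Y -> freemod k Y''}) t :
  (forall u, f' (f u) = f'' u) -> (forall v, g' (g v) = g'' v) ->
  tmap f' g' (tmap f g t) = tmap f'' g'' t.
Proof.
move=> ff gg; move: t; apply: linear_basis_ext => [a u v|a u v|p].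
- by rewrite !linearP.
- by rewrite linearP.
rewrite !tmap_basis -ff -gg; move: (f _) (g _) => u v.
move: u; apply: linear_basis_ext => [a u w|a u w|x].
- by rewrite !(tens_linearl, linearP).
- by rewrite !(tens_linearl, linearP).
move: v; apply: linear_basis_ext => [a v w|a v w|y].
- by rewrite !(tens_linearr, linearP).
- by rewrite !(tens_linearr, linearP).
by rewrite tens_basis tmap_basis.
Qed.

End FreeModules.

Section DiagonalProducts.
Variable k : fieldType.
Local Notation e := (basis k).

(* The basis elements in D act from the left as orthogonal projections, and u y
   is the element of D which fixes y.  Products with elements supported on D are
   then pointwise: see left_diagonalE. *)
Definition left_diagonal (X : finType)
    (m : {linear freemod k (X * X)%type -> freemod k X})
    (D : pred X) (u : X -> X) : Prop :=
  (forall y, D (u y))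
  /\ forall x y, D x -> m (e (x, y)) = (x == u y)%:R *: e y.

Definition right_diagonal (X : finType)
    (m : {linear freemod k (X * X)%type -> freemod k X})
    (D : pred X) (u : X -> X) : Prop :=
  (forall y, D (u y))
  /\ forall x y, D y -> m (e (x, y)) = (y == u x)%:R *: e x.

(** Diagonality passes to tensor products, so one evaluation rule serves the tensor powers in which
    [mul2] and [mul3] live. *)
Lemma left_diagonal_tmul (X Y : finType)
    (m : {linear freemod k (X * X)%type -> freemod k X})
    (n : {linear freemod k (Y * Y)%type -> freemod k Y}) D D' u u' :
  left_diagonal m D u -> left_diagonal n D' u' ->
  left_diagonal (tmul m n) [pred p | D p.1 && D' p.2]
    (fun p => (u p.1, u' p.2)).
Proof.
move=> [Du mD] [Du' nD']; split=> [y|[x x'] [y y'] /andP[/= Dx Dx']].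
  by rewrite /= Du Du'.
rewrite /tmul linext_basis /= !tens_basis mD // nD' // xpair_eqE -mulnb natrM.
apply/ffunP => -[z z']; rewrite !ffunE /= xpair_eqE -mulnb natrM.
by rewrite mulrACA.
Qed.

Lemma right_diagonal_tmul (X Y : finType)
    (m : {linear freemod k (X * X)%type -> freemod k X})
    (n : {linear freemod k (Y * Y)%type -> freemod k Y}) D D' u u' :
  right_diagonal m D u -> right_diagonal n D' u' ->
  right_diagonal (tmul m n) [pred p | D p.1 && D' p.2]
    (fun p => (u p.1, u' p.2)).
Proof.
move=> [Du mD] [Du' nD']; split=> [y|[x x'] [y y'] /andP[/= Dy Dy']].
  by rewrite /= Du Du'.
rewrite /tmul linext_basis /= !tens_basis mD // nD' // xpair_eqE -mulnb natrM.
apply/ffunP => -[z z']; rewrite !ffunE /= xpair_eqE -mulnb natrM.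
by rewrite mulrACA.
Qed.

Lemma left_diagonalE (X : finType)
    (m : {linear freemod k (X * X)%type -> freemod k X}) D u (s t : freemod k X) y :
  left_diagonal m D u -> (forall x, ~~ D x -> s x = 0) ->
  m (tens s t) y = s (u y) * t y.
Proof.
move=> [Du mD] sD; rewrite linE sum_ffunE sum_pair (bigD1 (u y)) //=.
rewrite [X in _ + X]big1 ?addr0 => [|x xy].
  rewrite (bigD1 y) //= big1 ?addr0 => [|z zy].
    by rewrite mD // !ffunE !eqxx scale1r /=; exact: mulr1.
  rewrite mD // !ffunE (eq_sym y) (negbTE zy).
  by rewrite scaler0; exact: mulr0.
(* Outside [D], [s] vanishes. For [x] in [D] other than [u y] the product is a multiple of [e z],
   which is nonzero at [y] only if [z = y], and then the scalar is 0. *)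
apply: big1 => z _; case Dx: (D x); last by rewrite !ffunE sD ?Dx //= mul0r scale0r.
rewrite mD // !ffunE; have [xz|_] := eqVneq; last by rewrite scale0r; exact: mulr0.
have /negbTE-> : y != z by apply: contraNneq xy => ->; apply/eqP.
by rewrite scaler0; exact: mulr0.
Qed.

Lemma right_diagonalE (X : finType)
    (m : {linear freemod k (X * X)%type -> freemod k X}) D u (s t : freemod k X) x :
  right_diagonal m D u -> (forall y, ~~ D y -> t y = 0) ->
  m (tens s t) x = s x * t (u x).
Proof.
move=> [Du mD] tD; rewrite linE sum_ffunE sum_pair (bigD1 x) //=.
rewrite [X in _ + X]big1 ?addr0 => [|z zx].
  rewrite (bigD1 (u x)) //= big1 ?addr0 => [|z zx].
    by rewrite mD // !ffunE !eqxx scale1r /=; exact: mulr1.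
  rewrite !ffunE; case Dz: (D z); last by rewrite tD ?Dz // mulr0 scale0r.
  rewrite mD // (negbTE zx) !ffunE.
  by rewrite scale0r; exact: mulr0.
apply: big1 => y _; rewrite !ffunE.
case Dy: (D y); last by rewrite tD ?Dy // mulr0 scale0r.
rewrite mD // !ffunE (eq_sym x) (negbTE zx).
by rewrite scaler0; exact: mulr0.
Qed.

End DiagonalProducts.

(** * Vacant double groupoids *)

Section DoubleGroupoids.
Variables (B H V P : Type) (T : double_groupoid B H V P).
Implicit Types (A C D X Y : B) (x y : H) (g h : V).

Local Notation tp := (top T).
Local Notation bt := (bot T).
Local Notation lf := (left T).
Local Notation rg := (right T).
Local Notation vc := (vcomp T).
Local Notation hc := (hcomp T).
Local Notation src_h := (src (hedge T)).
Local Notation tgt_h := (tgt (hedge T)).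
Local Notation src_v := (src (vedge T)).
Local Notation tgt_v := (tgt (vedge T)).
Local Notation id_h := (idc (hedge T)).
Local Notation id_v := (idc (vedge T)).

Definition hid_box A := A = hid T (lf A).
Definition vid_box A := A = vid T (tp A).

(** * Sides of identities, composites and inverses *)

Lemma top_vid x : tp (vid T x) = x. Proof. exact: src_idc. Qed.
Lemma bot_vid x : bt (vid T x) = x. Proof. exact: tgt_idc. Qed.
Lemma left_hid g : lf (hid T g) = g. Proof. exact: src_idc. Qed.
Lemma right_hid g : rg (hid T g) = g. Proof. exact: tgt_idc. Qed.
Lemma left_vidE x : lf (vid T x) = id_v (src_h x). Proof. exact: left_vid. Qed.
Lemma right_vidE x : rg (vid T x) = id_v (tgt_h x). Proof. exact: right_vid. Qed.
Lemma top_hidE g : tp (hid T g) = id_h (src_v g). Proof. exact: top_hid. Qed.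
Lemma bot_hidE g : bt (hid T g) = id_h (tgt_v g). Proof. exact: bot_hid. Qed.

Lemma top_vc A C : bt A = tp C -> tp (vc A C) = tp A. Proof. exact: src_comp. Qed.
Lemma bot_vc A C : bt A = tp C -> bt (vc A C) = bt C. Proof. exact: tgt_comp. Qed.
Lemma left_vc A C : bt A = tp C -> lf (vc A C) = ccomp (vedge T) (lf A) (lf C).
Proof. exact: left_vcomp. Qed.
Lemma right_vc A C : bt A = tp C -> rg (vc A C) = ccomp (vedge T) (rg A) (rg C).
Proof. exact: right_vcomp. Qed.
Lemma left_hc A C : rg A = lf C -> lf (hc A C) = lf A. Proof. exact: src_comp. Qed.
Lemma right_hc A C : rg A = lf C -> rg (hc A C) = rg C. Proof. exact: tgt_comp. Qed.
Lemma top_hc A C : rg A = lf C -> tp (hc A C) = ccomp (hedge T) (tp A) (tp C).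
Proof. exact: top_hcomp. Qed.
Lemma bot_hc A C : rg A = lf C -> bt (hc A C) = ccomp (hedge T) (bt A) (bt C).
Proof. exact: bot_hcomp. Qed.

Lemma hc_vc A A' C C' : rg A = lf A' -> rg C = lf C' ->
  bt A = tp C -> bt A' = tp C' ->
  vc (hc A A') (hc C C') = hc (vc A C) (vc A' C').
Proof. exact: Defs.interchange. Qed.

Lemma vcA A C D : bt A = tp C -> bt C = tp D -> vc (vc A C) D = vc A (vc C D).
Proof. exact: Defs.compA. Qed.
Lemma hcA A C D : rg A = lf C -> rg C = lf D -> hc (hc A C) D = hc A (hc C D).
Proof. exact: Defs.compA. Qed.
Lemma vc_vidl A : vc (vid T (tp A)) A = A. Proof. exact: comp_idl. Qed.
Lemma vc_vidr A : vc A (vid T (bt A)) = A. Proof. exact: comp_idr. Qed.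
Lemma hc_hidl A : hc (hid T (lf A)) A = A. Proof. exact: comp_idl. Qed.
Lemma hc_hidr A : hc A (hid T (rg A)) = A. Proof. exact: comp_idr. Qed.

Lemma vid_idem x : vc (vid T x) (vid T x) = vid T x.
Proof. by rewrite -{1}(top_vid x) vc_vidl. Qed.
Lemma hid_idem g : hc (hid T g) (hid T g) = hid T g.
Proof. by rewrite -{1}(left_hid g) hc_hidl. Qed.

Lemma tgt_top A : tgt_h (tp A) = src_v (rg A). Proof. exact: corner_tr. Qed.
Lemma src_top A : src_h (tp A) = src_v (lf A). Proof. exact: corner_tl. Qed.
Lemma src_bot A : src_h (bt A) = tgt_v (lf A). Proof. exact: corner_bl. Qed.
Lemma tgt_bot A : tgt_h (bt A) = tgt_v (rg A). Proof. exact: corner_br. Qed.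

Lemma top_vinv A : tp (vinv T A) = bt A.
Proof. exact: (src_inv (vinvP T)). Qed.
Lemma bot_vinv A : bt (vinv T A) = tp A.
Proof. exact: (tgt_inv (vinvP T)). Qed.
Lemma left_hinv A : lf (hinv T A) = rg A.
Proof. exact: (src_inv (hinvP T)). Qed.
Lemma right_hinv A : rg (hinv T A) = lf A.
Proof. exact: (tgt_inv (hinvP T)). Qed.
Lemma vc_vinv A : vc A (vinv T A) = vid T (tp A).
Proof. exact: (comp_inv (vinvP T)). Qed.
Lemma vinv_vc A : vc (vinv T A) A = vid T (bt A).
Proof. exact: (inv_comp (vinvP T)). Qed.
Lemma hc_hinv A : hc A (hinv T A) = hid T (lf A).
Proof. exact: (comp_inv (hinvP T)). Qed.
Lemma hinv_hc A : hc (hinv T A) A = hid T (rg A).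
Proof. exact: (inv_comp (hinvP T)). Qed.
Lemma vinvK : involutive (vinv T). Proof. exact: invK (vinvP T). Qed.
Lemma hinvK : involutive (hinv T). Proof. exact: invK (hinvP T). Qed.

(** The right side is functorial for vertical composition, so it sends inverses to inverses. *)
Lemma right_vinv A : rg (vinv T A) = vedge_inv T (rg A).
Proof.
apply: (inv_unique (vedge_invP T)); first by rewrite -tgt_bot -tgt_top top_vinv.
by rewrite -right_vc ?top_vinv // vc_vinv right_vidE tgt_top.
Qed.

Lemma top_hinv A : tp (hinv T A) = hedge_inv T (tp A).
Proof.
apply: (inv_unique (hedge_invP T)); first by rewrite tgt_top src_top left_hinv.
by rewrite -top_hc ?left_hinv // hc_hinv top_hidE src_top.
Qed.

Lemma bot_hinv A : bt (hinv T A) = hedge_inv T (bt A).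
Proof.
apply: (inv_unique (hedge_invP T)); first by rewrite tgt_bot src_bot left_hinv.
by rewrite -bot_hc ?left_hinv // hc_hinv bot_hidE src_bot.
Qed.

(** * Consequences of vacancy *)

Hypothesis vacT : vacant T.

Lemma box_ext_tr X Y : tp X = tp Y -> rg X = rg Y -> X = Y.
Proof.
move=> tXY rXY; case: (vacT (tgt_top X)) => Z [_ uZ].
by rewrite -(uZ X) // (uZ Y).
Qed.

(** The vertical inverse swaps top and bottom and inverts the right side, which reduces this to
    [box_ext_tr]. *)
Lemma box_ext_br X Y : bt X = bt Y -> rg X = rg Y -> X = Y.
Proof.
move=> bXY rXY; apply: (inv_inj vinvK); apply: box_ext_tr.
  by rewrite !top_vinv.
by rewrite !right_vinv rXY.
Qed.

Lemma box_ext_tl X Y : tp X = tp Y -> lf X = lf Y -> X = Y.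
Proof.
move=> tXY lXY; apply: (inv_inj hinvK); apply: box_ext_tr.
  by rewrite !top_hinv tXY.
by rewrite !right_hinv.
Qed.

Lemma box_tr x g : tgt_h x = src_v g -> exists A, tp A = x /\ rg A = g.
Proof. by move=> xg; case: (vacT xg) => A [? _]; exists A. Qed.

Lemma box_br x g : tgt_h x = tgt_v g -> exists A, bt A = x /\ rg A = g.
Proof.
move=> xg; case: (@box_tr x (vedge_inv T g)) => [|A [tA rA]].
  by rewrite (src_inv (vedge_invP T)).
by exists (vinv T A); rewrite bot_vinv right_vinv rA (invK (vedge_invP T)).
Qed.

Lemma box_tl x g : src_h x = src_v g -> exists A, tp A = x /\ lf A = g.
Proof.
move=> xg; case: (@box_tr (hedge_inv T x) g) => [|A [tA rA]].
  by rewrite (tgt_inv (hedge_invP T)).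
by exists (hinv T A); rewrite left_hinv top_hinv tA (invK (hedge_invP T)).
Qed.

(** The corner condition forces the top of [A] to be the identity of the upper end of its right
    side, so [A] and [hid T (rg A)] share top and right. *)
Lemma top_idc_hid A p : tp A = id_h p -> A = hid T (rg A).
Proof.
move=> tA; apply: box_ext_tr; rewrite ?right_hid // top_hidE -tgt_top tA.
by rewrite tgt_idc.
Qed.

Lemma bot_idc_hid A p : bt A = id_h p -> A = hid T (rg A).
Proof.
move=> bA; apply: box_ext_br; rewrite ?right_hid // bot_hidE -tgt_bot bA.
by rewrite tgt_idc.
Qed.

Lemma right_idc_vid A p : rg A = id_v p -> A = vid T (tp A).
Proof.
move=> rA; apply: box_ext_tr; rewrite ?top_vid // right_vidE tgt_top rA.
by rewrite src_idc.
Qed.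

Lemma left_idc_vid A p : lf A = id_v p -> A = vid T (tp A).
Proof.
move=> lA; apply: box_ext_tl; rewrite ?top_vid // left_vidE src_top lA.
by rewrite src_idc.
Qed.

(** The composite takes its top from [A] and its bottom from [C]. Both are identity edges, and one
    such side is enough. *)
Lemma vc_hid_box A C : bt A = tp C -> hid_box (vc A C) -> hid_box A /\ hid_box C.
Proof.
rewrite /hid_box => AC h; have R X g : X = hid T g -> X = hid T (lf X).
  by move=> ->; rewrite left_hid.
split; apply: R.
  by apply: (@top_idc_hid _ (src_v (lf (vc A C)))); rewrite -(top_vc AC) h top_hidE left_hid.
by apply: (@bot_idc_hid _ (tgt_v (lf (vc A C)))); rewrite -(bot_vc AC) h bot_hidE left_hid.
Qed.

Lemma hc_vid_box A C : rg A = lf C -> vid_box (hc A C) -> vid_box A /\ vid_box C.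
Proof.
rewrite /vid_box => AC h; split.
  apply: (@left_idc_vid _ (src_h (tp (hc A C)))).
  by rewrite -(left_hc AC) {1}h left_vidE.
apply: (@right_idc_vid _ (tgt_h (tp (hc A C)))).
by rewrite -(right_hc AC) {1}h right_vidE.
Qed.

Lemma hid_box_vc A C : bt A = tp C -> hid_box A -> hid_box C ->
  hid_box (vc A C).
Proof.
move=> AC hA hC; rewrite /hid_box left_vc // {1}hA {1}hC.
(* The left edges meet because the identity edges at their ends agree and [idc] is injective. *)
apply: vcomp_hid; apply: (@idc_inj _ _ (hedge T)).
by rewrite -top_hidE -hC -AC {2}hA bot_hidE.
Qed.

Lemma vid_box_hc A C : rg A = lf C -> vid_box A -> vid_box C ->
  vid_box (hc A C).
Proof.
move=> AC vA vC; rewrite /vid_box top_hc // {1}vA {1}vC.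
by apply: hcomp_vid; rewrite tgt_top src_top AC.
Qed.

(* A2 is the box with the top of Y and the right side of A; vacancy forces C2,
   and A1, C1 are the remaining horizontal quotients. *)
Lemma vc_hc_lift A C X Y : bt A = tp C -> rg X = lf Y -> hc X Y = vc A C ->
  exists A1 A2 C1 C2, [/\ rg A1 = lf A2, rg C1 = lf C2, bt A1 = tp C1 & bt A2 = tp C2]
    /\ [/\ A = hc A1 A2, C = hc C1 C2, X = vc A1 C1 & Y = vc A2 C2].
Proof.
move=> AC XY eXY.
have rY : rg Y = ccomp (vedge T) (rg A) (rg C) by rewrite -(right_hc XY) eXY right_vc.
have rAC : tgt_v (rg A) = src_v (rg C) by rewrite -tgt_bot -tgt_top AC.
have [A2 [tA2 rA2]] : exists A2, tp A2 = tp Y /\ rg A2 = rg A.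
  by apply: box_tr; rewrite tgt_top rY src_comp.
have [C2 [tC2 rC2]] : exists C2, tp C2 = bt A2 /\ rg C2 = rg C.
  by apply: box_tr; rewrite tgt_bot rA2.
have Y2 : Y = vc A2 C2.
  by apply: box_ext_tr; rewrite ?top_vc ?right_vc // rA2 rC2.
have K D D2 : rg D = rg D2 -> D = hc (hc D (hinv T D2)) D2.
  move=> DD; rewrite hcA ?left_hinv ?right_hinv // hinv_hc -DD.
  by rewrite hc_hidr.
pose A1 := hc A (hinv T A2); pose C1 := hc C (hinv T C2).
have rA1 : rg A1 = lf A2 by rewrite right_hc ?left_hinv ?right_hinv.
have rC1 : rg C1 = lf C2 by rewrite right_hc ?left_hinv ?right_hinv.
have A1C1 : bt A1 = tp C1.
  by rewrite bot_hc ?left_hinv // top_hc ?left_hinv // AC bot_hinv top_hinv tC2.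
have eA : A = hc A1 A2 by apply: K.
have eC : C = hc C1 C2 by apply: K.
clearbody A1 C1; exists A1, A2, C1, C2; split; split=> //.
(* [X] and [vc A1 C1] have the same horizontal composite with [Y], by interchange, and [Y]
   cancels. *)
apply: (comp_cancelr (hinvP T) (h := Y)) => //.
  change (rg (vc A1 C1) = lf Y).
  by rewrite Y2 right_vc // left_vc // rA1 rC1.
change (hc X Y = hc (vc A1 C1) Y).
by rewrite eXY Y2 eA eC; apply: hc_vc.
Qed.

(** [A2] has the top of [vc A2 C2] and the right side of [hc A1 A2], so vacancy determines it; then
    [C2] has a known top and right side, and cancellation gives [A1] and [C1]. *)
Lemma vc_hc_lift_unique A1 A2 C1 C2 A1' A2' C1' C2' :
  rg A1 = lf A2 -> rg C1 = lf C2 -> bt A2 = tp C2 ->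
  rg A1' = lf A2' -> rg C1' = lf C2' -> bt A2' = tp C2' ->
  hc A1 A2 = hc A1' A2' -> hc C1 C2 = hc C1' C2' -> vc A2 C2 = vc A2' C2' ->
  [/\ A1 = A1', A2 = A2', C1 = C1' & C2 = C2'].
Proof.
move=> rA rC AC rA' rC' AC' eA eC e2.
have eA2 : A2 = A2'.
  apply: box_ext_tr; first by rewrite -(top_vc AC) e2 top_vc.
  by rewrite -(right_hc rA) eA right_hc.
have eC2 : C2 = C2'.
  apply: box_ext_tr; first by rewrite -AC -AC' eA2.
  by rewrite -(right_hc rC) eC right_hc.
subst A2' C2'; split=> //.
  exact: (comp_cancelr (hinvP T) rA rA' eA).
exact: (comp_cancelr (hinvP T) rC rC' eC).
Qed.

End DoubleGroupoids.

(** * The twisted groupoid algebra *)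

Section TwistedAlgebra.
Variables (k : fieldType) (B H V P : finType) (T : double_groupoid B H V P).
Variables (sigma tau : B -> B -> k).
Hypotheses (vacT : vacant T) (st : normalized_cocycle T sigma tau).
Implicit Types (A C D : B) (x y : H) (g h : V).

Local Notation e := (basis k).
Local Notation W := (twisted_alg T sigma tau).
Local Notation tp := (top T).
Local Notation bt := (bot T).
Local Notation lf := (left T).
Local Notation rg := (right T).
Local Notation vc := (vcomp T).
Local Notation hc := (hcomp T).
Local Notation is_vid A := (A == vid T (tp A)).

(** * Values of the cocycle on identities and inverses *)

Lemma is_vidE x : is_vid (vid T x). Proof. by rewrite top_vid. Qed.

(** Apply the compatibility of [sigma] and [tau] to the array with both rows [vid T x], [vid T y].
    All values of [sigma] are 1, so the nonzero value of [tau] equals its own square. *)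
Lemma tau_vid x y : rg (vid T x) = lf (vid T y) -> tau (vid T x) (vid T y) = 1.
Proof.
move=> xy; have /eqP vv : is_vid (hc (vid T x) (vid T y)).
  by apply/eqP/vid_box_hc => //; rewrite /vid_box top_vid.
have := sigma_tau st xy xy; rewrite !bot_vid !top_vid => /(_ erefl erefl).
rewrite vv (sigma_vidl st) ?bot_vid ?top_vid //.
rewrite !(sigma_vidl st) ?bot_vid ?top_vid // !mulr1 mul1r.
by rewrite !vid_idem -[LHS]mulr1 => /(mulfI (tau_neq0 st xy)) <-.
Qed.

(** Dual to [tau_vid], with an array of two equal columns. *)
Lemma sigma_hid g h : bt (hid T g) = tp (hid T h) ->
  sigma (hid T g) (hid T h) = 1.
Proof.
move=> gh; have /= := hid_box_vc gh; rewrite /hid_box !left_hid => /(_ erefl erefl) vv.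
have := sigma_tau st (A := hid T g) (A' := hid T g) (C := hid T h) (C' := hid T h).
rewrite !right_hid !left_hid => /(_ erefl erefl gh gh).
rewrite vv (tau_hidl st) ?left_hid ?right_hid //.
rewrite !(tau_hidl st) ?left_hid ?right_hid // !mulr1 mul1r.
by rewrite !hid_idem -[LHS]mul1r => /(mulIf (sigma_neq0 st gh)) <-.
Qed.

(** This is the cocycle identity for [A], [vinv T A], [A], in which normalization makes the other
    two values 1. *)
Lemma sigma_vinv A : sigma A (vinv T A) = sigma (vinv T A) A.
Proof.
have := sigma_cocycle st (A := A) (C := vinv T A) (D := A).
rewrite top_vinv bot_vinv vc_vinv vinv_vc => /(_ erefl erefl).
by rewrite (sigma_vidl st) ?bot_vid // (sigma_vidr st) ?top_vid // !mulr1.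
Qed.

Lemma tau_hinv A : tau A (hinv T A) = tau (hinv T A) A.
Proof.
have := tau_cocycle st (A := A) (C := hinv T A) (D := A).
rewrite left_hinv right_hinv hc_hinv hinv_hc => /(_ erefl erefl).
by rewrite (tau_hidl st) ?right_hid // (tau_hidr st) ?left_hid // !mulr1.
Qed.

(** * Structure maps on the basis of boxes *)

Lemma twisted_mult_basis A C : twisted_mult T sigma (e (A, C)) =
  if bt A == tp C then sigma A C *: e (vc A C) else 0.
Proof. exact: linext_basis. Qed.

Lemma twisted_antipode_basis A : twisted_antipode T sigma tau (e A) =
  ((tau A (hinv T A))^-1 * (sigma (vinv T (hinv T A)) (hinv T A))^-1)
      *: e (vinv T (hinv T A)).
Proof. exact: linext_basis. Qed.

Lemma twisted_oneE A : twisted_one k T A = (is_vid A)%:R.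
Proof.
rewrite sum_ffunE; case: eqP => [vA|nvA].
  rewrite (bigD1 (tp A)) //= big1 => [|x xA]; last first.
    rewrite basisE; case: eqP => // Ax.
    by case/eqP: xA; rewrite Ax top_vid.
  by rewrite basisE -vA eqxx addr0.
by apply: big1 => x _; rewrite basisE; case: eqP => // Ax; case: nvA; rewrite Ax top_vid.
Qed.

Lemma twisted_comultE (a : freemod k B) A C : twisted_comult T tau a (A, C) =
  if rg A == lf C then tau A C * a (hc A C) else 0.
Proof.
rewrite linextE.
have E D : (\sum_(p : B * B | (rg p.1 == lf p.2) && (D == hc p.1 p.2))
      tau p.1 p.2 *: tens (e p.1) (e p.2)) (A, C)
    = if (rg A == lf C) && (D == hc A C) then tau A C else 0.
  rewrite sum_ffunE big_mkcond (bigD1 (A, C)) //= big1 => [|[A' C'] ne].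
    case: ifP => _; last exact: addr0.
    by rewrite !ffunE /= !eqxx addr0 mul1r; exact: mulr1.
  case: ifP => // _; rewrite tens_basis !ffunE eq_sym (negbTE ne).
  exact: mulr0.
rewrite (eq_bigr _ (fun D _ => congr1 (fun z => a D * z) (E D))).
case: eqP => [AC|_]; last by apply: big1 => D _; exact: mulr0.
rewrite (bigD1 (hc A C)) //= eqxx big1 => [|D /negbTE->]; last exact: mulr0.
by rewrite addr0 mulrC.
Qed.

Lemma twisted_counitE (a : freemod k B) :
  twisted_counit k T a = \sum_g a (hid T g).
Proof.
rewrite /twisted_counit /= /linext.
transitivity (\sum_(A | A == hid T (lf A)) (a A : k)).
  rewrite [RHS]big_mkcond; apply: eq_bigr => A _.
  by case: ifP => _; [exact: mulr1 | exact: mulr0].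
rewrite (reindex_onto (hid T) lf) => [|A /eqP/esym//].
by apply: eq_bigl => g; rewrite left_hid !eqxx.
Qed.

(** Composability with a vertical identity selects the boxes with matching top, and normalization of
    [sigma] makes the scalar 1. *)
Lemma left_diagonal_mult :
  left_diagonal (twisted_mult T sigma) [pred A | is_vid A] (fun A => vid T (tp A)).
Proof.
split=> [A|A C /= /eqP vA]; first exact: is_vidE.
rewrite twisted_mult_basis vA bot_vid.
case: eqP => [->|ne].
  by rewrite vc_vidl (sigma_vidl st) ?bot_vid // eqxx.
case: eqP => [e1|_]; last by rewrite scale0r.
by case: ne; rewrite -(top_vid T (tp A)) e1 top_vid.
Qed.

Lemma right_diagonal_mult :
  right_diagonal (twisted_mult T sigma) [pred A | is_vid A] (fun A => vid T (bt A)).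
Proof.
split=> [A|A C /= /eqP vC]; first exact: is_vidE.
rewrite twisted_mult_basis vC top_vid.
case: eqP => [<-|ne].
  by rewrite vc_vidr (sigma_vidr st) ?top_vid // eqxx.
case: eqP => [e1|_]; last by rewrite scale0r.
by case: ne; rewrite -(top_vid T (tp C)) e1 top_vid.
Qed.

Lemma wmul_linearl (c : freemod k B) : linear (fun a => wmul W a c).
Proof. by move=> z u v; rewrite /wmul tens_linearl linearP. Qed.

Lemma wmul_linearr (a : freemod k B) : linear (fun c => wmul W a c).
Proof. by move=> z u v; rewrite /wmul tens_linearr linearP. Qed.

Lemma wmul_basis A C : wmul W (e A) (e C) =
  if bt A == tp C then sigma A C *: e (vc A C) else 0.
Proof. by rewrite /wmul tens_basis twisted_mult_basis. Qed.

Lemma wmul_diagl (a c : freemod k B) C : (forall A, ~~ is_vid A -> a A = 0) ->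
  wmul W a c C = a (vid T (tp C)) * c C.
Proof. exact: (left_diagonalE c C left_diagonal_mult). Qed.

Lemma wmul_diagr (a c : freemod k B) A : (forall A, ~~ is_vid A -> c A = 0) ->
  wmul W a c A = a A * c (vid T (bt A)).
Proof. exact: (right_diagonalE a A right_diagonal_mult). Qed.

Lemma wmulZl z (a c : freemod k B) : wmul W (z *: a) c = z *: wmul W a c.
Proof.
(* The instance with scalar -1 and zero vectors shows that the map sends 0 to 0. *)
have := wmul_linearl c z a 0; have := wmul_linearl c (-1) 0 0.
by rewrite !scaler0 !addr0 scaleN1r addNr => ->; rewrite addr0.
Qed.

Lemma wmulZr z (a c : freemod k B) : wmul W a (z *: c) = z *: wmul W a c.
Proof.
have := wmul_linearr a z c 0; have := wmul_linearr a (-1) 0 0.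
by rewrite !scaler0 !addr0 scaleN1r addNr => ->; rewrite addr0.
Qed.

Lemma wmul0r (c : freemod k B) : wmul W 0 c = 0.
Proof. by rewrite -[X in wmul W X](scale0r 0) wmulZl scale0r. Qed.

Lemma wmulr0 (c : freemod k B) : wmul W c 0 = 0.
Proof. by rewrite -[X in wmul W _ X](scale0r 0) wmulZr scale0r. Qed.

(** * Algebra and coalgebra axioms *)

Lemma twisted_mulA (a b c : freemod k B) :
  wmul W a (wmul W b c) = wmul W (wmul W a b) c.
Proof.
move: a; apply: linear_basis_ext => [z u v|z u v|A];
  rewrite ?(wmul_linearl, wmul_linearr) //.
move: b; apply: linear_basis_ext => [z u v|z u v|C];
  rewrite ?(wmul_linearl, wmul_linearr) //.
move: c; apply: linear_basis_ext => [z u v|z u v|D];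
  rewrite ?(wmul_linearl, wmul_linearr) //.
rewrite !wmul_basis; case: (eqVneq (bt C) (tp D)) => [CD|nCD]; last first.
  rewrite wmulr0; case: eqP => [AC|_]; last by rewrite wmul0r.
  by rewrite wmulZl wmul_basis bot_vc // (negbTE nCD) scaler0.
rewrite wmulZr wmul_basis top_vc //; case: eqP => [AC|_].
  rewrite wmulZl wmul_basis bot_vc // CD eqxx !scalerA vcA //.
  by rewrite (sigma_cocycle st).
by rewrite wmul0r scaler0.
Qed.

Lemma twisted_mul1 (a : freemod k B) : wmul W (twisted_one k T) a = a.
Proof.
apply/ffunP => A; rewrite wmul_diagl => [|C nC]; last first.
  by rewrite twisted_oneE (negbTE nC).
by rewrite twisted_oneE is_vidE mul1r.
Qed.

Lemma twisted_mulr1 (a : freemod k B) : wmul W a (twisted_one k T) = a.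
Proof.
apply/ffunP => A; rewrite wmul_diagr => [|C nC]; last first.
  by rewrite twisted_oneE (negbTE nC).
by rewrite twisted_oneE is_vidE mulr1.
Qed.

Lemma twisted_coassoc (a : freemod k B) :
  tmap (comult W) (idlin k B) (comult W a)
  = reassoc (tmap (idlin k B) (comult W) (comult W a)).
Proof.
apply/ffunP => -[[A C] D]; rewrite [RHS]ffunE tmap_idr tmap_idl /=.
rewrite !twisted_comultE !ffunE !twisted_comultE.
case: (eqVneq (rg A) (lf C)) => [AC|nAC]; last first.
  by case: eqP => // CD; rewrite left_hc // (negbTE nAC) mulr0.
rewrite right_hc //; case: eqP => [CD|_]; last exact: mulr0.
by rewrite left_hc // AC eqxx !mulrA hcA // (tau_cocycle st).
Qed.

(** Among the horizontal identities summed by the counit, only the one on the left side of [A]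
    composes with [A], and [tau] is 1 there. *)
Lemma twisted_counitl (a : freemod k B) :
  form_id B (counit W) (comult W a) = a.
Proof.
apply/ffunP => A; rewrite form_idE /= twisted_counitE (bigD1 (lf A)) //=.
rewrite big1 ?addr0 => [|g /negbTE gA]; rewrite ffunE twisted_comultE right_hid.
  by rewrite eqxx hc_hidl (tau_hidl st) ?right_hid // mul1r.
by rewrite gA.
Qed.

Lemma twisted_counitr (a : freemod k B) :
  id_form B (counit W) (comult W a) = a.
Proof.
apply/ffunP => A; rewrite id_formE /= twisted_counitE (bigD1 (rg A)) //=.
rewrite big1 ?addr0 => [|g /negbTE gA]; rewrite ffunE twisted_comultE left_hid.
  by rewrite eqxx hc_hidr (tau_hidr st) ?left_hid // mul1r.
by rewrite eq_sym gA.
Qed.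

(** * Multiplicativity of the comultiplication *)

Lemma wmul_basisE A C X : wmul W (e A) (e C) X =
  if (bt A == tp C) && (X == vc A C) then sigma A C else 0.
Proof.
rewrite wmul_basis; case: eqP => _ /=; last by rewrite ffunE.
by rewrite !ffunE; case: eqP => _; [exact: mulr1 | exact: mulr0].
Qed.

Lemma comult_basis D A C : comult W (e D) (A, C) =
  if (rg A == lf C) && (D == hc A C) then tau A C else 0.
Proof.
rewrite twisted_comultE basisE [_ == D]eq_sym; case: eqP => //= _.
by case: eqP => _; rewrite ?mulr1 ?mulr0.
Qed.

Lemma mul2E (s t : freemod k (B * B)%type) X Y :
  mul2 W s t (X, Y) = \sum_r s r.1 * t r.2 *
    (wmul W (e r.1.1) (e r.2.1) X * wmul W (e r.1.2) (e r.2.2) Y).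
Proof. by rewrite linextE; apply: eq_bigr => r _; rewrite !ffunE. Qed.

(** For boxes [A] and [C], the right-hand coefficient at [(X, Y)] sums over two-by-two arrays whose
    rows compose to [A], [C] and whose columns compose to [X], [Y]. Vacancy leaves at most one
    array, present exactly when [hc X Y = vc A C] with both composites defined. *)
Lemma twisted_comult_mul (a b : freemod k B) :
  comult W (wmul W a b) = mul2 W (comult W a) (comult W b).
Proof.
move: a; apply: linear_basis_ext => [z u v|z u v|A].
- by rewrite wmul_linearl linearP.
- by rewrite /mul2 linearP tens_linearl linearP.
move: b; apply: linear_basis_ext => [z u v|z u v|C].
- by rewrite wmul_linearr linearP.
- by rewrite /mul2 linearP tens_linearr linearP.
apply/ffunP => -[X Y]; rewrite mul2E wmul_basis.
pose cond (r : (B * B) * (B * B)) :=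
  [&& (rg r.1.1 == lf r.1.2) && (A == hc r.1.1 r.1.2),
      (rg r.2.1 == lf r.2.2) && (C == hc r.2.1 r.2.2),
      (bt r.1.1 == tp r.2.1) && (X == vc r.1.1 r.2.1) &
      (bt r.1.2 == tp r.2.2) && (Y == vc r.1.2 r.2.2)].
have term0 r : ~~ cond r -> comult W (e A) r.1 * comult W (e C) r.2 *
    (wmul W (e r.1.1) (e r.2.1) X * wmul W (e r.1.2) (e r.2.2) Y) = 0.
  case: r => [[A1 A2] [C1 C2]]; rewrite /cond /= !comult_basis !wmul_basisE.
  case: ifP => _; last by rewrite !mul0r.
  case: ifP => _; last by rewrite mulr0 mul0r.
  case: ifP => _; last by rewrite mul0r mulr0.
  by case: ifP => // _; rewrite !mulr0.
(* Without an array the left side vanishes too, since a factorization [hc X Y = vc A C] would lift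
   to one. *)
case: (pickP cond) => [[[A1 A2] [C1 C2]]|nocond]; last first.
  rewrite big1 => [|r _]; last by rewrite term0 ?nocond.
  case: eqP => [AC|_]; last by rewrite linear0 ffunE.
  rewrite twisted_comultE; case: eqP => // XY.
  rewrite ffunE basisE; case: eqP => [E|_]; last by rewrite [_ *: _]mulr0 mulr0.
  have [A1 [A2 [C1 [C2 [[h1 h2 h3 h4] [h5 h6 h7 h8]]]]]] := vc_hc_lift vacT AC XY E.
  have := nocond ((A1, A2), (C1, C2)); rewrite /cond /=.
  by rewrite -h5 -h6 -h7 -h8 h1 h2 h3 h4 !eqxx.
rewrite /cond /= => /and4P[/andP[/eqP h1 /eqP eA] /andP[/eqP h2 /eqP eC]
  /andP[/eqP h3 /eqP eX] /andP[/eqP h4 /eqP eY]].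
(* By uniqueness of the lift, a single term is left. *)
rewrite (bigD1 ((A1, A2), (C1, C2))) //= [X in _ + X]big1 ?addr0; last first.
  case=> [[A1' A2'] [C1' C2']] ne; rewrite term0 //; apply: contraNN ne.
  rewrite /cond /= => /and4P[/andP[/eqP h1' /eqP eA'] /andP[/eqP h2' /eqP eC']
    /andP[/eqP h3' /eqP eX'] /andP[/eqP h4' /eqP eY']].
  have [] := vc_hc_lift_unique vacT (A1 := A1) (A2 := A2) (C1 := C1) (C2 := C2)
    (A1' := A1') (A2' := A2') (C1' := C1') (C2' := C2') => //.
  - by rewrite -eA.
  - by rewrite -eC.
  - by rewrite -eY.
  by move=> -> -> -> ->.
have AC : bt A = tp C by rewrite eA eC bot_hc // top_hc // h3 h4.
have XY : rg X = lf Y by rewrite eX eY right_vc // left_vc // h1 h2.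
rewrite AC eqxx twisted_comultE !comult_basis !wmul_basisE XY h1 h2 h3 h4 /=.
rewrite -eA -eC -eX -eY !eqxx /= ffunE basisE.
have -> : hc X Y = vc A C by rewrite eX eY eA eC hc_vc.
(* The remaining scalars are the two sides of the compatibility of [sigma] and [tau] for this
   array. *)
rewrite eqxx [_ *: _]mulr1 mulrA -(sigma_tau st) // -eA -eC -eX -eY.
by rewrite mulrC.
Qed.

(** * Comultiplication of the unit *)

Lemma comult_oneE A C : comult W (twisted_one k T) (A, C) =
  [&& rg A == lf C, is_vid A & is_vid C]%:R.
Proof.
rewrite twisted_comultE twisted_oneE; case: eqP => //= AC.
case: (boolP (is_vid A && is_vid C)) => [/andP[/eqP vA /eqP vC]|nAC].
  have /eqP-> : hc A C = vid T (tp (hc A C)) by apply: vid_box_hc.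
  by rewrite vA vC tau_vid ?mulr1 // -vA -vC.
case: eqP => [/(hc_vid_box vacT AC)[/eqP vA /eqP vC]|_]; last by rewrite mulr0.
by rewrite vA vC in nAC.
Qed.

Lemma comult2_oneE A C D : comult2 W (twisted_one k T) ((A, C), D) =
  [&& rg A == lf C, rg C == lf D, is_vid A, is_vid C & is_vid D]%:R.
Proof.
rewrite /comult2 tmap_idr [LHS]twisted_comultE ffunE comult_oneE.
case: eqP => //= AC; rewrite right_hc //; case: eqP => //= _; last by rewrite mulr0.
case: (boolP (is_vid A && is_vid C)) => [/andP[/eqP vA /eqP vC]|nAC].
  have /eqP-> : hc A C = vid T (tp (hc A C)) by apply: vid_box_hc.
  have -> : tau A C = 1 by rewrite vA vC tau_vid // -vA -vC.
  have /eqP-> := vA; have /eqP-> := vC.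
  by rewrite mul1r.
have /negbTE-> : ~~ is_vid (hc A C).
  by apply: contraNN nAC => /eqP/(hc_vid_box vacT AC)[/eqP-> /eqP->].
by rewrite andbA (negbTE nAC) mulr0.
Qed.

Lemma mul3_diagl (s t : freemod k (B * B * B)%type) A C D :
  (forall p, ~~ [&& is_vid p.1.1, is_vid p.1.2 & is_vid p.2] -> s p = 0) ->
  mul3 W s t ((A, C), D) =
  s ((vid T (tp A), vid T (tp C)), vid T (tp D)) * t ((A, C), D).
Proof.
move=> s0; have dm := left_diagonal_mult.
apply: (left_diagonalE _ _
  (left_diagonal_tmul (left_diagonal_tmul dm dm) dm)) => p /= np.
by apply: s0; rewrite andbA.
Qed.

Lemma mul2_diagl (s t : freemod k (B * B)%type) A C :
  (forall p, ~~ (is_vid p.1 && is_vid p.2) -> s p = 0) ->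
  mul2 W s t (A, C) = s (vid T (tp A), vid T (tp C)) * t (A, C).
Proof.
by move=> s0; apply: (left_diagonalE _ _
  (left_diagonal_tmul left_diagonal_mult left_diagonal_mult)).
Qed.

Lemma mul2_diagr (s t : freemod k (B * B)%type) A C :
  (forall p, ~~ (is_vid p.1 && is_vid p.2) -> t p = 0) ->
  mul2 W s t (A, C) = s (A, C) * t (vid T (bt A), vid T (bt C)).
Proof.
by move=> s0; apply: (right_diagonalE _ _
  (right_diagonal_tmul right_diagonal_mult right_diagonal_mult)).
Qed.

(** The left factor is supported on triples of vertical identities, so the product is pointwise.
    Both sides are indicators of composable triples of vertical identities, which leaves a Boolean
    identity. *)
Lemma twisted_comult2_one_l : comult2 W (twisted_one k T)
  = mul3 W (tens (comult W (twisted_one k T)) (twisted_one k T))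
           (reassoc (tens (twisted_one k T) (comult W (twisted_one k T)))).
Proof.
apply/ffunP => -[[A C] D]; rewrite comult2_oneE mul3_diagl => [|[[X Y] Z] /=].
  rewrite !ffunE /= !comult_oneE !twisted_oneE !is_vidE !andbT mulr1.
  rewrite -!natrM !mulnb; congr (nat_of_bool _)%:R.
  have [/eqP vA|] := boolP (is_vid A); last by rewrite !andbF.
  have [/eqP vC|] := boolP (is_vid C); last by rewrite !andbF.
  by rewrite -vA -vC; do !case: (_ == _).
rewrite !ffunE /= comult_oneE twisted_oneE -natrM mulnb => nd.
by move: nd; do !case: (_ == _).
Qed.

Lemma twisted_comult2_one_r : comult2 W (twisted_one k T)
  = mul3 W (reassoc (tens (twisted_one k T) (comult W (twisted_one k T))))
           (tens (comult W (twisted_one k T)) (twisted_one k T)).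
Proof.
apply/ffunP => -[[A C] D]; rewrite comult2_oneE mul3_diagl => [|[[X Y] Z] /=].
  rewrite !ffunE /= !comult_oneE !twisted_oneE !is_vidE !andbT mul1r.
  rewrite -!natrM !mulnb; congr (nat_of_bool _)%:R.
  have [/eqP vA|] := boolP (is_vid A); last by rewrite !(andbF, andFb).
  have [/eqP vC|] := boolP (is_vid C); last by rewrite !(andbF, andFb).
  have [/eqP vD|] := boolP (is_vid D); last by rewrite !(andbF, andFb).
  by rewrite -vC -vD; do !case: (_ == _).
rewrite !ffunE /= comult_oneE twisted_oneE -natrM mulnb => nd.
by move: nd; do !case: (_ == _).
Qed.


(** * Counit of a product *)

Local Notation is_hid A := (A == hid T (lf A)).
Local Notation S := (twisted_antipode T sigma tau).

(** A vertical composite is a horizontal identity only if both factors are, and [sigma] is 1 on such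
    pairs. *)
Lemma counit_wmul_basis A C : counit W (wmul W (e A) (e C)) =
  [&& is_hid A, is_hid C & bt A == tp C]%:R.
Proof.
rewrite wmul_basis; case: (eqVneq (bt A)) => [AC|_]; last first.
  by rewrite !andbF linear0.
rewrite andbT linearZ /= [twisted_counit k T _]linext_basis.
case: (boolP (is_hid A && is_hid C)) => [/andP[/eqP hA /eqP hC]|nAC].
  have /eqP-> : hid_box T (vc A C) by apply: hid_box_vc.
  by rewrite hA hC sigma_hid -?hA -?hC //; exact: mulr1.
case: eqP => [/(vc_hid_box vacT AC)[/eqP hA /eqP hC]|_]; last exact: mulr0.
by rewrite hA hC in nAC.
Qed.

Lemma counit_wmul3_basis A C D :
  counit W (wmul W (wmul W (e A) (e C)) (e D)) =
  ([&& is_hid A, is_hid C & bt A == tp C]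
   && [&& is_hid C, is_hid D & bt C == tp D])%:R.
Proof.
rewrite wmul_basis; case: (eqVneq (bt A)) => [AC|_]; last first.
  by rewrite !andbF wmul0r linear0.
rewrite andbT wmulZl linearZ counit_wmul_basis bot_vc //=.
case: (boolP (is_hid A && is_hid C)) => [/andP[/eqP hA /eqP hC]|nAC].
  have /eqP-> : hid_box T (vc A C) by apply: hid_box_vc.
  have /eqP-> := hC; rewrite hA hC sigma_hid -?hA -?hC //; exact: mul1r.
case: eqP => [/(vc_hid_box vacT AC)[/eqP hA /eqP hC]|_]; last exact: mulr0.
by rewrite hA hC in nAC.
Qed.

(** Two horizontal identities compose horizontally only when they are equal, and the composite is
    again that box. So [(D, D)] is the only factorization that [F] sees, with [tau] equal to 1. *)
Lemma sum_comult_hid D (F : B * B -> k) :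
  (forall p, ~~ (is_hid p.1 && is_hid p.2) -> F p = 0) ->
  \sum_p comult W (e D) p * F p = (is_hid D)%:R * F (D, D).
Proof.
move=> F0; rewrite (bigD1 (D, D)) //= big1 ?addr0 => [|[X Y] XY].
  have [hD|nD] := eqVneq D (hid T (lf D)); last first.
    by rewrite F0 ?mulr0 //= (negbTE nD).
  have rD : rg D = lf D by rewrite hD right_hid left_hid.
  have DD : hc D D = D by rewrite {1}hD hc_hidl.
  by rewrite comult_basis rD DD !eqxx /= {1}hD (tau_hidl st) ?right_hid.
case: (boolP (is_hid X && is_hid Y)) => [/andP[/eqP hX /eqP hY]|n]; last first.
  by rewrite F0 ?mulr0.
rewrite comult_basis; case: ifP; last by rewrite mul0r.
case/andP=> /eqP eXY /eqP DXY; case/eqP: XY.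
have eX : X = Y by rewrite hX hY -eXY hX right_hid left_hid.
have XX : hc X X = X by rewrite {1}hX hc_hidl.
by rewrite DXY -eX XX.
Qed.

(** One proof for both counit axioms: [sw] is the identity or the swap, and it fixes the diagonal
    pairs, the only ones that survive. *)
Lemma counit_wmul3 (sw : B * B -> B * B) (a b c : freemod k B) :
  (forall A, sw (A, A) = (A, A)) ->
  (forall p, is_hid (sw p).1 && is_hid (sw p).2 -> is_hid p.1 && is_hid p.2) ->
  counit W (wmul W (wmul W a b) c) = \sum_(p : B * B) comult W b p *
    (counit W (wmul W a (e (sw p).1)) * counit W (wmul W (e (sw p).2) c)).
Proof.
move=> sw_diag sw_hid.
move: a; apply: (@linear_basis_ext k B k^o) => [z u v||A].
- by rewrite !(wmul_linearl, linearP).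
- apply: linear_sum_fun => p; apply/linear_mull/linear_mulr => z u v.
  by rewrite wmul_linearl linearP.
move: c; apply: (@linear_basis_ext k B k^o) => [z u v||C].
- by rewrite wmul_linearr linearP.
- apply: linear_sum_fun => p; apply/linear_mull/linear_mull => z u v.
  by rewrite wmul_linearr linearP.
move: b; apply: (@linear_basis_ext k B k^o) => [z u v||D].
- by rewrite wmul_linearr wmul_linearl linearP.
- apply: linear_sum_fun => p; apply: linear_mulr => z u v.
  by rewrite linearP !ffunE.
rewrite sum_comult_hid => [|p]; last first.
  rewrite !counit_wmul_basis -natrM mulnb => /(contraNN (sw_hid p)).
  by do !case: (_ == _).
rewrite sw_diag counit_wmul3_basis !counit_wmul_basis -!natrM !mulnb.
by do !case: (_ == _).
Qed.

Lemma twisted_counit_mul_l (a b c : freemod k B) :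
  counit W (wmul W (wmul W a b) c) = \sum_(p : B * B) comult W b p *
    (counit W (wmul W a (e p.1)) * counit W (wmul W (e p.2) c)).
Proof. exact: (@counit_wmul3 id). Qed.

Lemma twisted_counit_mul_r (a b c : freemod k B) :
  counit W (wmul W (wmul W a b) c) = \sum_(p : B * B) comult W b p *
    (counit W (wmul W a (e p.2)) * counit W (wmul W (e p.1) c)).
Proof.
by apply: (@counit_wmul3 (fun p => (p.2, p.1))) => // p; rewrite andbC.
Qed.

(** * Counital maps *)

Lemma comult_one_support p : ~~ (is_vid p.1 && is_vid p.2) ->
  comult W (twisted_one k T) p = 0.
Proof. by case: p => A C nAC; rewrite comult_oneE (negbTE nAC) andbF. Qed.

(** The product with [comult W (twisted_one k T)] is pointwise and compares the vertical identities
    on the tops of [hid T g] and [A]. These compose horizontally exactly when [g] starts at the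
    source of the top of [A]. *)
Lemma counital_targetE (h : freemod k B) A : counital_target W h A =
  (is_vid A)%:R * \sum_(g | src (vedge T) g == src (hedge T) (tp A)) h (hid T g).
Proof.
rewrite /counital_target form_idE twisted_counitE [in RHS]big_mkcond mulr_sumr.
apply: eq_bigr => g _.
rewrite ffunE (mul2_diagl _ _ _ comult_one_support) comult_oneE !is_vidE !andbT.
rewrite right_vidE left_vidE (inj_eq (@idc_inj _ _ _)) top_hidE tgt_idc.
rewrite !ffunE twisted_oneE mulrC -mulrA mulrCA; congr (_ * _).
by case: eqP => _; rewrite ?mulr1 ?mulr0.
Qed.

(** The diagonal factor is now on the right, so bottoms replace tops and the target of [g] is
    tested. *)
Lemma counital_sourceE (h : freemod k B) A : counital_source W h A =
  (is_vid A)%:R * \sum_(g | tgt (vedge T) g == tgt (hedge T) (tp A)) h (hid T g).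
Proof.
rewrite /counital_source id_formE twisted_counitE [in RHS]big_mkcond mulr_sumr.
apply: eq_bigr => g _.
rewrite ffunE (mul2_diagr _ _ _ comult_one_support) comult_oneE !is_vidE !andbT.
rewrite right_vidE left_vidE (inj_eq (@idc_inj _ _ _)) bot_hidE src_idc.
rewrite !ffunE /= twisted_oneE -mulrA; case: eqP => [vA|_]; last by rewrite !mul0r.
rewrite {1}vA bot_vid eq_sym; congr (_ * _).
by case: eqP => _; rewrite ?mulr1 ?mulr0.
Qed.


(** * Antipode axioms *)

Lemma mult_tmapE (f g : {linear freemod k B -> freemod k B}) t D :
  mult W (tmap f g t) D =
  \sum_X \sum_Y t (X, Y) * wmul W (f (e X)) (g (e Y)) D.
Proof.
rewrite -(sum_pair (fun p => t p * wmul W (f (e p.1)) (g (e p.2)) D)).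
have -> : tmap f g t = \sum_p (t p : k) *: tens (f (e p.1)) (g (e p.2)) by [].
rewrite linear_sum sum_ffunE; apply: eq_bigr => p _.
by rewrite linearZ ffunE.
Qed.

(* In [m (id * S) Delta] and [m (S * id) Delta] only the factorizations
   [X X^h] of horizontal identities survive. *)
Lemma sum_antipode (h : freemod k B) (K : B -> B -> freemod k B)
    (G : B -> B) D :
  (forall X Y, rg X = lf Y -> K X Y =
     if Y == hinv T X then (tau X Y)^-1 *: e (G X) else 0) ->
  \sum_X \sum_Y comult W h (X, Y) * K X Y D =
  \sum_X h (hid T (lf X)) * (D == G X)%:R.
Proof.
move=> KE; apply: eq_bigr => X _; rewrite (bigD1 (hinv T X)) //=.
rewrite [X in _ + X]big1 ?addr0 => [|Y /negbTE nY].
  have rX : rg X = lf (hinv T X) by rewrite left_hinv.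
  rewrite twisted_comultE KE // eqxx {1}rX eqxx hc_hinv !ffunE.
  rewrite [_^-1 *: _]/(_ * _) mulrACA mulfV ?mul1r //.
  exact: (tau_neq0 st).
rewrite twisted_comultE; case: eqP => [XY|_]; last by rewrite mul0r.
by rewrite KE // nY ffunE mulr0.
Qed.

(** [X] and [hinv T Y] have the same right side, and composability says that they have the same
    bottom, so vacancy identifies them. *)
Lemma antipode_composable_r X Y : rg X = lf Y ->
  (bt X == tp (vinv T (hinv T Y))) = (Y == hinv T X).
Proof.
move=> XY; rewrite top_vinv; apply/eqP/eqP => [bX|->]; last by rewrite hinvK.
apply: (canRL (hinvK T)); apply/esym/(box_ext_br vacT) => //.
by rewrite right_hinv.
Qed.

Lemma antipode_composable_l X Y : rg X = lf Y ->
  (bt (vinv T (hinv T X)) == tp Y) = (Y == hinv T X).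
Proof.
move=> XY; rewrite bot_vinv; apply/eqP/eqP => [tX|->] //.
by apply/esym/(box_ext_tl vacT) => //; rewrite left_hinv.
Qed.

(** The [sigma] of the product cancels the one in the antipode by [sigma_vinv]. The inverse of [tau]
    remains, to cancel the [tau] of the comultiplication. *)
Lemma wmul_antipode_r X Y : rg X = lf Y -> wmul W (e X) (S (e Y)) =
  if Y == hinv T X then (tau X Y)^-1 *: e (vid T (tp X)) else 0.
Proof.
move=> XY; rewrite twisted_antipode_basis wmulZr wmul_basis.
rewrite antipode_composable_r //; case: eqP => [->|_]; last by rewrite scaler0.
rewrite hinvK vc_vinv scalerA -mulrA sigma_vinv mulVf ?mulr1.
  by rewrite tau_hinv.
by apply: (sigma_neq0 st); rewrite bot_vinv.
Qed.

Lemma wmul_antipode_l X Y : rg X = lf Y -> wmul W (S (e X)) (e Y) =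
  if Y == hinv T X then (tau X Y)^-1 *: e (vid T (bt Y)) else 0.
Proof.
move=> XY; rewrite twisted_antipode_basis wmulZl wmul_basis.
rewrite antipode_composable_l //; case: eqP => [->|_]; last by rewrite scaler0.
rewrite vinv_vc scalerA -mulrA mulVf ?mulr1 //.
by apply: (sigma_neq0 st); rewrite bot_vinv.
Qed.

(** Reindexing along a bijection from [Q] to [R], applied to the boxes with a fixed top or bottom,
    which vacancy matches with their left or right sides. *)
Lemma sum_fiber (I J : finType) (Q : pred I) (R : pred J) (f : I -> J)
    (F : J -> k) : {in Q &, injective f} -> (forall i, Q i -> R (f i)) ->
  (forall j, R j -> exists i, Q i /\ f i = j) ->
  \sum_(i | Q i) F (f i) = \sum_(j | R j) F j.
Proof.
move=> finj QR Rf; pose A := [set i | Q i].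
transitivity (\sum_(i in A) F (f i)); first by apply: eq_bigl => i; rewrite inE.
rewrite -big_imset /= => [|i i']; last by rewrite !inE; exact: finj.
apply: eq_bigl => j; apply/imsetP/idP => [[i]|Rj].
  by rewrite inE => Qi ->; exact: QR.
by have [i [Qi fi]] := Rf j Rj; exists i; rewrite ?inE.
Qed.

Lemma eq_vid D x : (D == vid T x) = is_vid D && (tp D == x).
Proof.
apply/eqP/andP => [->|[/eqP vD /eqP <-//]].
by rewrite is_vidE top_vid.
Qed.

Lemma twisted_antipode_target (h : freemod k B) :
  mult W (tmap (idlin k B) S (comult W h)) = counital_target W h.
Proof.
apply/ffunP => D; rewrite mult_tmapE counital_targetE /=.
rewrite (@sum_antipode _ (fun X Y => wmul W (e X) (S (e Y)))
  (fun X => vid T (tp X))); last exact: wmul_antipode_r.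
under [LHS]eq_bigr => X _ do rewrite eq_vid.
case: (is_vid D) => /=; last by rewrite mul0r big1 // => X _; rewrite mulr0.
rewrite mul1r -(@sum_fiber _ _ (fun X => tp X == tp D) _ lf (fun g => h (hid T g))).
- rewrite [RHS]big_mkcond; apply: eq_bigr => X _; rewrite eq_sym.
  by case: eqP => _; rewrite ?mulr1 ?mulr0.
- move=> X Y /eqP tX /eqP tY; apply: (box_ext_tl vacT); rewrite ?tX ?tY //.
- by move=> X /eqP <-; rewrite src_top.
move=> g /eqP/esym gD; have [X [tX lX]] := box_tl vacT gD.
by exists X; rewrite tX.
Qed.

Lemma twisted_antipode_source (h : freemod k B) :
  mult W (tmap S (idlin k B) (comult W h)) = counital_source W h.
Proof.
apply/ffunP => D; rewrite mult_tmapE counital_sourceE /=.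
rewrite (@sum_antipode _ (fun X Y => wmul W (S (e X)) (e Y))
  (fun X => vid T (bt (hinv T X)))); last first.
  by move=> X Y XY; rewrite wmul_antipode_l //; case: eqP => // ->.
(* Passing to horizontal inverses turns left sides into right sides and puts the condition on the
   bottom of [X] itself. *)
rewrite (reindex_inj (inv_inj (hinvK T))).
under [LHS]eq_bigr => X _ do rewrite left_hinv hinvK eq_vid.
case: (is_vid D) => /=; last by rewrite mul0r big1 // => X _; rewrite mulr0.
rewrite mul1r -(@sum_fiber _ _ (fun X => bt X == tp D) _ rg (fun g => h (hid T g))).
- rewrite [RHS]big_mkcond; apply: eq_bigr => X _; rewrite eq_sym.
  by case: eqP => _; rewrite ?mulr1 ?mulr0.
- move=> X Y /eqP tX /eqP tY; apply: (box_ext_br vacT); rewrite ?tX ?tY //.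
- by move=> X /eqP <-; rewrite tgt_bot.
move=> g /eqP/esym gD; have [X [bX rX]] := box_br vacT gD.
by exists X; rewrite bX.
Qed.

Lemma counital_source_basis X A : counital_source W (e X) A =
  [&& is_vid A, is_hid X & tgt (vedge T) (lf X) == tgt (hedge T) (tp A)]%:R.
Proof.
rewrite counital_sourceE; case: (is_vid A); rewrite ?mul0r // mul1r /=.
case: eqP => [hX|nX] /=; last first.
  apply: big1 => g _; rewrite basisE; case: eqP => // E.
  by case: nX; rewrite -E left_hid.
rewrite big_mkcond (bigD1 (lf X)) //= [X in _ + X]big1 ?addr0 => [|g gX].
  by rewrite basisE -hX eqxx; case: ifP.
rewrite basisE; case: (hid T g =P X) => [E|_]; last by case: ifP.
by case/eqP: gX; rewrite -E left_hid.
Qed.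

(** The first two legs multiply to the source counital map, so this is the convolution of
    [counital_source W] with [S]. Only the horizontal identity on the left side of [Y] contributes,
    and its counital image fixes [S (e Y)]. *)
Lemma twisted_antipode_antipode (h : freemod k B) :
  mult W (tmap (mult W) (idlin k B)
    (tmap (tmap S (idlin k B)) S (comult2 W h))) = S h.
Proof.
rewrite /comult2 (tmap_tmap (f'' := tmap S (idlin k B) \o comult W) (g'' := S)) //.
rewrite (tmap_tmap (f'' := counital_source W) (g'' := S)) //; last first.
  exact: twisted_antipode_source.
apply/ffunP => D; rewrite mult_tmapE exchange_big (linE S) sum_ffunE.
apply: eq_bigr => Y _ /=; rewrite (bigD1 (hid T (lf Y))) //= [X in _ + X]big1.
  rewrite addr0 twisted_comultE right_hid eqxx hc_hidl (tau_hidl st) ?right_hid //.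
  rewrite mul1r [RHS]ffunE wmul_diagl => [|A nA]; last first.
    by rewrite counital_source_basis (negbTE nA).
  congr (_ * _); rewrite twisted_antipode_basis !ffunE.
  case: (D =P vinv T (hinv T Y)) => [->|_]; last by rewrite [_ *: _]mulr0 mulr0.
  rewrite counital_source_basis is_vidE left_hid eqxx top_vid top_vinv /=.
  by rewrite tgt_bot right_hinv eqxx mul1r.
(* Any other [X] composable with [Y] is not a horizontal identity, so its source counital image is
   0. *)
move=> X nX; rewrite twisted_comultE; case: eqP => [XY|_]; last by rewrite mul0r.
rewrite wmul_diagl => [|A nA]; last by rewrite counital_source_basis (negbTE nA).
rewrite counital_source_basis is_vidE; case: eqP => [hX|_]; last first.
  by rewrite mul0r mulr0.
by case/eqP: nX; rewrite -XY {2}hX right_hid.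
Qed.

Lemma twisted_quantum_groupoid : quantum_groupoid W.
Proof.
split.
- exact: twisted_mulA.
- exact: twisted_mul1.
- exact: twisted_mulr1.
- exact: twisted_coassoc.
- exact: twisted_counitl.
- exact: twisted_counitr.
- exact: twisted_comult_mul.
- exact: twisted_comult2_one_l.
- exact: twisted_comult2_one_r.
- exact: twisted_counit_mul_l.
- exact: twisted_counit_mul_r.
- exact: twisted_antipode_target.
- exact: twisted_antipode_source.
- exact: twisted_antipode_antipode.
Qed.


(** * Source and target subalgebras *)

Section Fibers.
Variable s : H -> P.
Hypothesis s_surj : forall p, exists x, s x = p.

(** With [s] the source or the target of horizontal edges this is [one_from] or [one_to], so both
    subalgebras are treated at once. *)
Definition fiber_one (p : P) : freemod k B := \sum_(x | s x == p) e (vid T x).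

Local Notation U := <<[seq fiber_one p | p : P]>>%VS.

Lemma fiber_oneE p A : fiber_one p A = (is_vid A && (s (tp A) == p))%:R.
Proof.
rewrite sum_ffunE; case: eqP => [vA|nA] /=; last first.
  by apply: big1 => x _; rewrite basisE eq_vid; case: eqP.
under eq_bigr => x _ do rewrite basisE eq_vid -vA eqxx /=.
rewrite big_mkcond (bigD1 (tp A)) //= [X in _ + X]big1 ?addr0 => [|x /negbTE xA].
  by rewrite eqxx; case: ifP.
by rewrite [tp A == x]eq_sym xA; case: ifP.
Qed.

Definition fiber_comb (c : P -> k) : freemod k B := \sum_p c p *: fiber_one p.

Lemma fiber_combE (c : P -> k) A :
  fiber_comb c A = (is_vid A)%:R * c (s (tp A)).
Proof.
rewrite sum_ffunE (bigD1 (s (tp A))) //= [X in _ + X]big1 ?addr0 => [|p np].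
  by rewrite ffunE fiber_oneE eqxx andbT; exact: mulrC.
by rewrite ffunE fiber_oneE [_ == p]eq_sym (negbTE np) andbF; exact: mulr0.
Qed.

Lemma fiber_comb_in (c : P -> k) : fiber_comb c \in U.
Proof.
apply: memv_suml => p _; apply/memvZ/memv_span.
by apply/imageP; exists p.
Qed.

Lemma span_fiber_one a : a \in U -> exists c, a = fiber_comb c.
Proof.
rewrite span_def big_image /= => /memv_sumP[v vU ->].
have vp p : exists c : k, v p = c *: fiber_one p by apply/vlineP/vU.
have [c vc] := fin_all_exists vp.
by exists c; apply: eq_bigr => p _.
Qed.

(** Through [fiber_comb] the span is an image of the functions on [P] with pointwise product, and
    the constant 1 goes to the unit. *)
Lemma fiber_subalgebra_commutative : commutative_subalgebra W U.
Proof.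
have diag (c : P -> k) A : ~~ is_vid A -> fiber_comb c A = 0.
  by move=> nA; rewrite fiber_combE (negbTE nA) mul0r.
have prod (c d : P -> k) : 
    wmul W (fiber_comb c) (fiber_comb d) = fiber_comb (fun p => c p * d p).
  apply/ffunP => A; rewrite wmul_diagl; last exact: diag.
  rewrite !fiber_combE is_vidE top_vid mul1r.
  by rewrite mulrCA.
split=> [|_ _ /span_fiber_one[c ->] /span_fiber_one[d ->]|].
- have -> : unit_elt W = fiber_comb (fun=> 1); last exact: fiber_comb_in.
  by apply/ffunP => A; rewrite fiber_combE twisted_oneE mulr1.
- by rewrite prod fiber_comb_in.
move=> _ _ /span_fiber_one[c ->] /span_fiber_one[d ->].
by rewrite !prod; apply: eq_bigr => p _; rewrite [c p * _]mulrC.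
Qed.

Lemma dim_fiber_subalgebra : \dim U = #|P|.
Proof.
have /eqnP-> : free [seq fiber_one p | p : P]; last exact: size_image.
apply/(freeP (X := image_tuple fiber_one predT)) => c c0 i.
have [x sx] := s_surj (enum_val i).
(* Evaluation at the vertical identity of an edge over the [i]-th point isolates [c i]. *)
have /ffunP/(_ (vid T x)) := c0; rewrite sum_ffunE ffunE.
rewrite (bigD1 i) //= [X in _ + X]big1 => [|j ji]; rewrite ffunE.
  by rewrite nth_image fiber_oneE is_vidE top_vid sx eqxx addr0 => <-; exact/esym/mulr1.
rewrite nth_image fiber_oneE is_vidE top_vid sx (inj_eq enum_val_inj) eq_sym.
by rewrite (negbTE ji); exact: mulr0.
Qed.

(** [f h] is the [fiber_comb] of the sums of [h] over the fibers of [r]; conversely [fiber_one p] is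
    the image of [e (hid T g)] for any [g] over [p]. *)
Lemma limg_fiber_one (f : {linear freemod k B -> freemod k B}) (r : V -> P) :
  (forall p, exists g, r g = p) ->
  (forall (h : freemod k B) A, f h A =
    (is_vid A)%:R * \sum_(g | r g == s (tp A)) h (hid T g)) ->
  limg (linfun f) = U.
Proof.
move=> r_surj fE; apply/eqP; rewrite eqEsubv; apply/andP; split; apply/subvP => a.
  case/memv_imgP=> h _ ->; rewrite lfunE /=.
  have -> : f h = fiber_comb (fun p => \sum_(g | r g == p) h (hid T g)).
    by apply/ffunP => A; rewrite fE fiber_combE.
  exact: fiber_comb_in.
case/span_fiber_one=> c ->; apply: memv_suml => p _; apply: memvZ.
have [g rg] := r_surj p; apply/memv_imgP; exists (e (hid T g)).
  exact: memvf.
rewrite lfunE /=; apply/ffunP => A; rewrite fE fiber_oneE -mulnb natrM.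
congr (_ * _); rewrite big_mkcond (bigD1 g) //= [X in _ + X]big1 ?addr0.
  by rewrite rg basisE eqxx eq_sym; case: ifP.
move=> g' g'g; rewrite basisE (inj_eq (@idc_inj _ _ _)) (negbTE g'g).
by case: ifP.
Qed.

End Fibers.

Lemma source_subalgebraE :
  source_subalgebra W = <<[seq one_to k T p | p : P]>>%VS.
Proof.
apply: (limg_fiber_one (r := tgt (vedge T))) counital_sourceE => p.
by exists (idc (vedge T) p); rewrite tgt_idc.
Qed.

Lemma target_subalgebraE :
  target_subalgebra W = <<[seq one_from k T p | p : P]>>%VS.
Proof.
apply: (limg_fiber_one (r := src (vedge T))) counital_targetE => p.
by exists (idc (vedge T) p); rewrite src_idc.
Qed.

End TwistedAlgebra.

(** * Diagonal isomorphisms *)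

Section Rescaling.
Variables (k : fieldType) (B H V P : finType) (T : double_groupoid B H V P).
Variables (sigma tau nu eta : B -> B -> k) (psi : B -> k).
Hypotheses (st : normalized_cocycle T sigma tau).
Hypotheses (ne : normalized_cocycle T nu eta) (psi0 : forall A, psi A != 0).

Local Notation e := (basis k).
Local Notation W := (twisted_alg T sigma tau).
Local Notation W' := (twisted_alg T nu eta).

Lemma rescaleE (phi : B -> k) (a : freemod k B) A :
  rescale phi a A = phi A * a A.
Proof.
rewrite linextE (bigD1 A) //= [X in _ + X]big1 ?addr0 => [|C /negbTE CA].
  by rewrite !ffunE eqxx [_ *: _]mulr1 mulrC.
by rewrite !ffunE eq_sym CA [_ *: _]mulr0 mulr0.
Qed.

Lemma rescale_basis (phi : B -> k) A : rescale phi (e A) = phi A *: e A.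
Proof. exact: linext_basis. Qed.

Lemma tmap_rescale (phi : B -> k) t A C :
  tmap (rescale phi) (rescale phi) t (A, C) = phi A * phi C * t (A, C).
Proof.
rewrite linextE (bigD1 (A, C)) //= [X in _ + X]big1 ?addr0 => [|[X Y] XY].
  by rewrite ffunE /= !rescaleE !basisE !eqxx !mulr1 mulrC.
rewrite ffunE /= !rescaleE !basisE mulrACA -natrM mulnb.
by rewrite -xpair_eqE eq_sym (negbTE XY) !mulr0.
Qed.

(** Multiplicativity and comultiplicativity on basis boxes are the two equations. Conversely, these
    force [psi] to be 1 on identities, which yields the unit, the counit and the antipode. *)
Lemma rescale_isoP : quantum_groupoid_iso W W' (rescale psi) <->
  (forall A A' : B, bot T A = top T A' ->
     psi (vcomp T A A') * sigma A A' = psi A * psi A' * nu A A')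
  /\ (forall C D : B, right T C = left T D ->
     psi (hcomp T C D) * eta C D = psi C * psi D * tau C D).
Proof.
split=> [[_ psiM _ psiD _ _]|[psiM psiD]].
  split=> [A A' AA'|C D CD].
    have /ffunP/(_ (vcomp T A A')) := psiM (e A) (e A').
    rewrite rescaleE !rescale_basis wmulZl wmulZr !wmul_basis AA' eqxx.
    by rewrite !scalerA !ffunE eqxx ![_ *: _]mulr1.
  have /ffunP/(_ (C, D)) := psiD (e (hcomp T C D)).
  rewrite tmap_rescale !twisted_comultE CD eqxx rescaleE basisE eqxx !mulr1.
  by move=> ->; rewrite mulrC.
(* Both cocycles are 1 on a repeated identity, so the nonzero value of [psi] equals its own
   square. *)
have psi_vid x : psi (vid T x) = 1.
  have := psiM (vid T x) (vid T x); rewrite bot_vid top_vid => /(_ erefl).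
  rewrite (sigma_vidl st) ?bot_vid ?top_vid // (sigma_vidl ne) ?bot_vid ?top_vid //.
  rewrite vid_idem !mulr1 -{1}[psi _]mulr1.
  by move/(mulfI (psi0 _)).
have psi_hid g : psi (hid T g) = 1.
  have := psiD (hid T g) (hid T g); rewrite right_hid left_hid => /(_ erefl).
  rewrite (tau_hidl st) ?left_hid ?right_hid // (tau_hidl ne) ?left_hid ?right_hid //.
  rewrite hid_idem !mulr1 -{1}[psi _]mulr1.
  by move/(mulfI (psi0 _)).
split.
- by exists (rescale (fun A => (psi A)^-1)) => a; apply/ffunP => A;
    rewrite !rescaleE mulrA ?(mulVf (psi0 A)) ?(mulfV (psi0 A)) mul1r.
- move=> a b; move: a; apply: linear_basis_ext => [z u v|z u v|A].
  + by rewrite wmul_linearl linearP.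
  + by rewrite linearP wmul_linearl.
  move: b; apply: linear_basis_ext => [z u v|z u v|C].
  + by rewrite wmul_linearr linearP.
  + by rewrite linearP wmul_linearr.
  rewrite !rescale_basis wmulZl wmulZr !wmul_basis.
  case: eqP => [AC|_]; last by rewrite linear0 !scaler0.
  rewrite linearZ /= rescale_basis !scalerA; congr (_ *: _).
  by rewrite mulrC psiM.
- apply/ffunP => A; rewrite rescaleE !twisted_oneE.
  by case: eqP => [->|_]; rewrite ?psi_vid ?mulr0 // mul1r.
- move=> a; apply/ffunP => -[A C]; rewrite tmap_rescale !twisted_comultE.
  case: eqP => [AC|_]; last by rewrite mulr0.
  by rewrite rescaleE mulrA -psiD // [RHS]mulrA [psi _ * _]mulrC.
- move=> a; rewrite !twisted_counitE; apply: eq_bigr => g _.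
  by rewrite rescaleE psi_hid mul1r.
apply: linear_basis_ext => [z u v|z u v|A]; rewrite ?linearP //.
rewrite rescale_basis linearZ !twisted_antipode_basis linearZ /= rescale_basis.
rewrite !scalerA; congr (_ *: _).
(* The composites of [(A, X)] and [(Y, X)] are identities, so the two equations express [eta A X]
   and [sigma Y X] through [tau A X] and [nu Y X]. *)
set X := hinv T A; set Y := vinv T X.
have := psiD A X; rewrite left_hinv => /(_ erefl).
rewrite hc_hinv psi_hid mul1r => ->.
have := psiM Y X; rewrite bot_vinv => /(_ erefl).
rewrite vinv_vc psi_vid mul1r => ->.
have tAX : tau A X != 0 by apply: (tau_neq0 st); rewrite left_hinv.
have nYX : nu Y X != 0 by apply: (sigma_neq0 ne); rewrite bot_vinv.
have := psi0 A; have := psi0 X; have := psi0 Y.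
by move=> *; field; do ?[apply/andP; split].
Qed.

End Rescaling.

Theorem theorem3p7 (k : fieldType) (B H V P : finType)
    (T : double_groupoid B H V P) (vacT : vacant T)
    (sigma tau : B -> B -> k) (st : normalized_cocycle T sigma tau) :
  [/\ quantum_groupoid (twisted_alg T sigma tau),
      source_subalgebra (twisted_alg T sigma tau)
        = <<[seq one_to k T p | p : P]>>%VS
      /\ target_subalgebra (twisted_alg T sigma tau)
        = <<[seq one_from k T p | p : P]>>%VS,
      commutative_subalgebra (twisted_alg T sigma tau)
        (source_subalgebra (twisted_alg T sigma tau))
      /\ commutative_subalgebra (twisted_alg T sigma tau)
        (target_subalgebra (twisted_alg T sigma tau))
    & \dim (source_subalgebra (twisted_alg T sigma tau)) = #|P|
      /\ \dim (target_subalgebra (twisted_alg T sigma tau)) = #|P|]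
  /\ (forall (nu eta : B -> B -> k) (psi : B -> k),
      normalized_cocycle T nu eta -> (forall A, psi A != 0) ->
      quantum_groupoid_iso (twisted_alg T sigma tau) (twisted_alg T nu eta)
        (rescale psi)
      <-> (forall A A' : B, bot T A = top T A' ->
             psi (vcomp T A A') * sigma A A' = psi A * psi A' * nu A A')
          /\ (forall C D : B, right T C = left T D ->
             psi (hcomp T C D) * eta C D = psi C * psi D * tau C D)).
Proof.
split; last by move=> nu eta psi ne psi0; exact: rescale_isoP.
rewrite (source_subalgebraE vacT st) (target_subalgebraE vacT st).
split=> //; first exact: twisted_quantum_groupoid.
  by split; apply: fiber_subalgebra_commutative.
(* Every point is the source and the target of its identity edge. *)
by split; apply: dim_fiber_subalgebra => p; exists (idc (hedge T) p);
  rewrite ?src_idc ?tgt_idc.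
Qed.
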